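(* Let $n\ge 2$ be an integer and let $\Theta=(\theta_1,\dots,\theta_n)\in\mathbf{R}^n$ be such that $1,\theta_1,\dots,\theta_n$ are linearly independent over $\mathbf{Q}$. For any integer $d$ with $1\le d\le n-1$, $$\omega_{d-1}(\Theta)\ge\frac{d\,\omega_d(\Theta)}{\omega_d(\Theta)+d+1}.$$ Furthermore, $$\omega_{n-2}(\Theta)\ge\frac{(\hat\omega_{n-1}(\Theta)-1)\,\omega_{n-1}(\Theta)}{\omega_{n-1}(\Theta)+\hat\omega_{n-1}(\Theta)}.$$
   Context: Identify $\Theta$ with the point of $\mathbf{P}^n(\mathbf{R})$ with homogeneous coordinates $(1,\theta_1,\dots,\theta_n)$. Equip $\mathbf{R}^{n+1}$ with the standard scalar product and its exterior algebra with the induced Euclidean norm $|\cdot|$ (wedge products of an orthonormal basis form an orthonormal basis). The projective distance between $P,Q\in\mathbf{P}^n(\mathbf{R})$ with homogeneous coordinates $\mathbf{x},\mathbf{y}$ is $\mathrm{d}(P,Q)=|\mathbf{x}\wedge\mathbf{y}|/(|\mathbf{x}||\mathbf{y}|)$, and for a linear subvariety $L$ of $\mathbf{P}^n(\mathbf{R})$, $\mathrm{d}(\Theta,L)=\min_{P\in L}\mathrm{d}(\Theta,P)$. If $L=\mathbf{P}(V)$ is rational over $\mathbf{Q}$ of dimension $d$, its height is $H(L)=|\mathbf{X}|$, where $\mathbf{X}\in\Lambda^{d+1}(\mathbf{Z}^{n+1})$ is a system of coprime integer Plücker coordinates of $V$. For $0\le d\le n-1$, $\omega_d(\Theta)$ is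 the supremum (possibly $+\infty$) of the real numbers $\omega$ for which there exist infinitely many rational linear subvarieties $L\subset\mathbf{P}^n(\mathbf{R})$ with $\dim L=d$ and $\mathrm{d}(\Theta,L)\le H(L)^{-1-\omega}$. $\hat\omega_{n-1}(\Theta)$ is the supremum (possibly $+\infty$) of the real numbers $\omega$ such that for all sufficiently large real $X$ there exists a non-zero integer $(n+1)$-tuple $(x_0,\dots,x_n)$ with $\max_{0\le i\le n}|x_i|\le X$ and $|x_0+x_1\theta_1+\cdots+x_n\theta_n|\le X^{-\omega}$. Convention: when exponents are infinite the right-hand sides are read in the limiting sense, i.e. as $\dfrac{d}{1+(d+1)/\omega_d(\Theta)}$ and $\dfrac{1-1/\hat\omega_{n-1}(\Theta)}{1/\omega_{n-1}(\Theta)+1/\hat\omega_{n-1}(\Theta)}$ with $1/\infty=0$, the latter being $+\infty$ if its denominator is $0$. *)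

(* Defs.v *)
From HB Require Import structures.
From mathcomp Require Import all_boot all_order all_algebra.
From mathcomp Require Import all_classical all_reals all_analysis.

Set Implicit Arguments.
Unset Strict Implicit.
Unset Printing Implicit Defensive.

Import Order.TTheory GRing.Theory Num.Theory.
Import numFieldNormedType.Exports.

Local Open Scope classical_set_scope.
Local Open Scope ring_scope.

Definition increasing (k m : nat) (f : {ffun 'I_k -> 'I_m}) : bool :=
  [forall i : 'I_k, forall j : 'I_k, (i < j)%N ==> (f i < f j)%N].

Definition multi_index (k m : nat) := {f : {ffun 'I_k -> 'I_m} | increasing f}.

(* The k-th exterior power of K^m, in coordinates on the basis
   e_(f 0) /\ ... /\ e_(f (k-1)), f increasing; for K = R this basis is
   orthonormal, so that l2norm below is the induced Euclidean norm. *)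
Definition ext_power (K : Type) (k m : nat) := {ffun multi_index k m -> K}.

Definition wedge (K : comNzRingType) (k m : nat) (A : 'M[K]_(k, m)) :
    ext_power K k m :=
  [ffun f : multi_index k m => \det (colsub (val f) A)].

Definition l2norm (R : realType) (I : finType) (x : I -> R) : R :=
  Num.sqrt (\sum_i x i ^+ 2).

Definition pdist (R : realType) (m : nat) (x y : 'rV[R]_m) : R :=
  l2norm (wedge (col_mx x y)) / (l2norm (x 0) * l2norm (y 0)).

(* A linear subvariety P(V) of P^(m-1)(R) is represented by V itself. The
   minimum over P(V) is taken as an infimum (attained, by compactness). *)
Definition pdist_sub (R : realType) (m : nat) (x : 'rV[R]_m)
    (V : {vspace 'rV[R]_m}) : R :=
  inf [set pdist x y | y in [set y : 'rV[R]_m | y \in V /\ y != 0]].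

Definition rational_sub (R : realType) (m : nat) (V : {vspace 'rV[R]_m}) : Prop :=
  exists X : seq 'rV[rat]_m, V = <<[seq map_mx ratr x | x <- X]>>%VS.

Definition plucker (R : realType) (m : nat) (V : {vspace 'rV[R]_m}) :
    ext_power R (\dim V) m :=
  wedge (\matrix_(i < \dim V) tnth (vbasis V) i).

(* Plucker coordinates are homogeneous: changing the basis of V multiplies
   them by a nonzero scalar, and all nonzero scalars occur (if V <> 0). *)
Definition coprime_plucker (R : realType) (m : nat) (V : {vspace 'rV[R]_m})
    (X : ext_power int (\dim V) m) : Prop :=
  (exists2 c : R, c != 0 & forall f, (X f)%:~R = c * plucker V f) /\
  (\big[gcdn/0]_f `|X f| = 1)%N.

Arguments coprime_plucker {R m} V X.

(* X is unique up to sign, see heightE; the default value 0 is only taken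
   when V is not rational. *)
Definition height (R : realType) (m : nat) (V : {vspace 'rV[R]_m}) : R :=
  xget 0 [set h | exists2 X, coprime_plucker V X & h = l2norm (fun f => (X f)%:~R)].

Lemma coprime_plucker_uniq (R : realType) (m : nat) (V : {vspace 'rV[R]_m})
    (X Y : ext_power int (\dim V) m) :
  coprime_plucker V X -> coprime_plucker V Y -> forall f, (`|X f| = `|Y f|)%N.
Proof.
move=> [[c c0 Xc] gX] [[c' c'0 Yc] gY] f.
have XY g : X f * Y g = X g * Y f.
  apply/eqP; rewrite -(eqr_int R) !rmorphM /= !Xc !Yc; apply/eqP.
  by rewrite mulrACA [RHS]mulrACA [plucker V f * _]mulrC.
have gM a (Z : ext_power int (\dim V) m) :
    (a * \big[gcdn/0]_g `|Z g| = \big[gcdn/0]_g (a * `|Z g|))%N.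
  by apply: (big_morph (muln a)) => [x y|]; rewrite ?muln0// muln_gcdr.
have -> : `|X f|%N = (`|X f| * \big[gcdn/0]_g `|Y g|)%N by rewrite gY muln1.
have -> : `|Y f|%N = (`|Y f| * \big[gcdn/0]_g `|X g|)%N by rewrite gX muln1.
by rewrite !gM; apply: eq_bigr => g _; rewrite -!abszM XY mulrC.
Qed.

Lemma heightE (R : realType) (m : nat) (V : {vspace 'rV[R]_m})
    (X : ext_power int (\dim V) m) :
  coprime_plucker V X -> height V = l2norm (fun f => (X f)%:~R : R).
Proof.
move=> hX; apply: xget_unique; first by exists X.
move=> h [Y hY ->]; congr Num.sqrt; apply: eq_bigr => f _.
rewrite -[LHS]real_normK ?num_real// -[RHS]real_normK ?num_real//.
by rewrite -!intr_norm -!abszE (coprime_plucker_uniq hY hX).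
Qed.

Definition hpoint (R : realType) (n : nat) (Theta : 'rV[R]_n) : 'rV[R]_n.+1 :=
  row_mx 1%:M Theta.

Definition lin_indep_over_Q (R : realType) (m : nat) (x : 'rV[R]_m) : Prop :=
  forall q : 'rV[rat]_m, \sum_i ratr (q 0 i) * x 0 i = 0 -> q = 0.

Definition omega (R : realType) (n d : nat) (Theta : 'rV[R]_n) : \bar R :=
  ereal_sup [set w%:E | w in [set w : R |
    infinite_set [set V : {vspace 'rV[R]_n.+1} |
      [/\ rational_sub V, \dim V = d.+1 &
          pdist_sub (hpoint Theta) V <= height V `^ (- 1 - w)]]]].

(* The uniform exponent in codimension one, i.e. of index n - 1. *)
Definition omega_hat (R : realType) (n : nat) (Theta : 'rV[R]_n) : \bar R :=
  ereal_sup [set w%:E | w in [set w : R |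
    \forall X \near +oo, exists x : 'rV[int]_n.+1,
      [/\ x != 0,
          forall i, `|x 0 i|%:~R <= X &
          `|\sum_i (x 0 i)%:~R * hpoint Theta 0 i| <= X `^ (- w)]]].

(* In the two definitions below, infinite exponents are read in the limiting
   sense; in \bar R, +oo^-1 = 0 and 0^-1 = +oo. *)
Definition going_down_bound (R : realType) (d : nat) (w : \bar R) : \bar R :=
  match w with
  | r%:E => (d%:R * r / (r + d%:R + 1))%:E
  | _ => (d%:R%:E / (1 + d.+1%:R%:E / w))%E
  end.

Definition uniform_bound (R : realType) (w what : \bar R) : \bar R :=
  match w, what with
  | r%:E, s%:E => ((s - 1) * r / (r + s))%:E
  | _, _ => ((1 - what^-1) / (w^-1 + what^-1))%E
  end.

(* Main.v *)
From HB Require Import structures.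
Require Import Defs.
From mathcomp Require Import all_boot all_order all_fingroup all_algebra.
From mathcomp Require Import all_classical all_reals all_analysis.
From mathcomp Require Import ring lra zify.

Set Implicit Arguments.
Unset Strict Implicit.
Unset Printing Implicit Defensive.

Import Order.TTheory GRing.Theory Num.Theory.
Import numFieldNormedType.Exports.

Local Open Scope ring_scope.

(** Write [x] for [hpoint Theta].  Since pdist is the sine of an angle, a
rational [V] is close to [x] exactly when it contains a point at small Euclidean
distance from [x] ([pdist_sub_le], [pdist_sub_approx]).

Going from dimension [d] to [d - 1].  Let [V] have projective dimension [d],
height [H], and distance at most [H^(-1-w)] to [x]; by Northcott's finiteness
[H] may be taken large ([northcott]).  Pick [y] in [V] close to [x].  The
hyperplanes of [V] are the kernels of primitive integral forms [c] on the
lattice of integer points of [V], a lattice of covolume [H]; the kernel of [c]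
has height [H |c|] and lies at distance [|c(y)| / |c|] from [y].  The dual
lattice has covolume [1 / H], so Minkowski's theorem on linear forms gives, for
every [b >= 1], some [c] with [|c|] bounded by [b] and [|c(y)|] by
[|y| / (H b^d)], up to constants ([rational_hyperplane]).  The resulting [W] of
height at most [D], of order at most [H b], satisfies
[dist(x, W) D <= C (H^(-w) b + b^(-d))], and [b = H^(w/(d+1))] balances the two
terms.  This gives every exponent smaller than [d w / (w + d + 1)]
([going_down]).

Using the uniform exponent.  Let the hyperplane [V] have integral normal vector
[a], so that [|a| = H], and put [p = |a . x|], which is about [H^(-w)] or less.
The uniform exponent [s], used at [X = 2 p^(-1/s)], gives an integral [c] with
[|c| <= X] up to a constant and [|c . x| < p].  Then [c] is not a multiple of
the primitive vector [a] ([gram2_gt0]), and the common kernel [W] of [a] and [c]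
satisfies [dist(x, W) H(W) <= |a . x| |c| + |c . x| |a|] and
[H(W) <= |a| |c|] ([intersection_of_hyperplanes]); this is the second inequality
([going_down_uniform]).

In both cases infinitely many subspaces arise because the distances obtained are
arbitrarily small but never zero, [x] lying in no proper rational subspace
([infinite_of_pdist_sub]).  The bounds with infinite exponents are limits of the
finite ones; the denominators are positive because [omega_hat] is at least [1]
by Dirichlet's theorem, whence [omega (n - 1)] is at least [1], and positivity
propagates to the other exponents by going down.

Heights are computed with the Cauchy-Binet formula: it identifies the squared
norm of Plücker coordinates with a Gram determinant, shows that the minors of
an integral basis are coprime, and shows that Plücker coordinates determine the
subspace.  The heights of kernels come from [gram_dual]. *)

(** * The Cauchy-Binet formula *)

Lemma increasingP (k m : nat) (f : {ffun 'I_k -> 'I_m}) :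
  reflect {homo f : i j / (i < j)%N} (increasing f).
Proof.
apply: (iffP forallP) => [h i j ij|h i].
  by have /forallP/(_ j)/implyP/(_ ij) := h i.
by apply/forallP => j; apply/implyP; apply: h.
Qed.

Lemma increasing_inj (k m : nat) (f : multi_index k m) : injective (val f).
Proof.
case: f => f /= /increasingP fi i j fij; apply/val_inj/eqP.
by case: (ltngtP i j) => // /fi; rewrite fij ltnn.
Qed.

(** An increasing map is the enumeration of its range, so the range fixes it. *)
Lemma increasing_range_inj (k m : nat) (f g : multi_index k m) :
  codom (val f) =i codom (val g) -> f = g.
Proof.
move=> fg; apply/val_inj/ffunP.
have srt (h : multi_index k m) : sorted ltn [seq val i | i <- codom (val h)].
  rewrite sorted_map codomE sorted_map.
  have := iota_ltn_sorted 0 k; rewrite -val_enum_ord sorted_map.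
  by apply: sub_sorted => i j /= ij; case: h => /= h /increasingP; apply.
suff /(inj_map val_inj) /eq_in_map e : [seq val i | i <- codom (val f)] =
    [seq val i | i <- codom (val g)].
  by move=> i; apply: e; rewrite mem_enum.
apply: (irr_sorted_eq ltn_trans ltnn (srt f) (srt g)).
move=> i; apply/mapP/mapP => -[j jf ->]; exists j => //; by rewrite ?fg // -fg.
Qed.

(** Sorting the values of [f] gives [g], and the sorting permutation gives [s]. *)
Lemma sort_injective (k m : nat) (f : {ffun 'I_k -> 'I_m}) : injective f ->
  exists (g : multi_index k m) (s : 'S_k), f = [ffun i => val g (s i)].
Proof.
move=> fi; pose r : rel 'I_m := fun i j => (i <= j)%N.
have rtr : transitive r by move=> x y z; exact: leq_trans.
have rtot : total r by move=> x y; exact: leq_total.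
have /tuple_permP[s fE] : perm_eq (mktuple f) (sort_tuple r (mktuple f)).
  by rewrite /= perm_sym perm_sort.
set t := sort_tuple r (mktuple f) in fE.
have st : size [seq val i | i <- t] = k by rewrite size_map size_tuple.
have ts : sorted ltn [seq val i | i <- t].
  rewrite ltn_sorted_uniq_leq map_inj_uniq; last exact: val_inj.
  rewrite sort_uniq map_inj_uniq // enum_uniq /= sorted_map.
  exact: (sort_sorted rtot).
have tE (i : 'I_k) : tnth t i = nth 0%N [seq val i | i <- t] i :> nat.
  by rewrite (nth_map (tnth t i)) ?size_tuple // -tnth_nth.
have gI : increasing [ffun i => tnth t i].
  apply/increasingP => i j ij; rewrite !ffunE !tE.
  by apply: (sorted_ltn_nth ltn_trans 0%N ts) => //; rewrite inE st.
have [g gE] : exists g : multi_index k m, val g = [ffun i => tnth t i].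
  by exists (exist (fun f => is_true (increasing f)) _ gI).
exists g, s; apply/ffunP => i; rewrite ffunE gE ffunE.
have /val_inj {}fE : val (mktuple f) = val [tuple tnth t (s i) | i < k] by [].
by have := congr1 (fun u : k.-tuple _ => tnth u i) fE; rewrite !tnth_mktuple.
Qed.

(** By multilinearity in the rows, [\det (A *m B)] is a sum over all maps [f]
from the rows of [A] to its columns.  Non-injective maps contribute zero, and
an injective map is uniquely an increasing one composed with a permutation;
summing over the permutations rebuilds the minors of [A]. *)
Lemma cauchy_binet (K : comNzRingType) (k m : nat)
    (A : 'M[K]_(k, m)) (B : 'M[K]_(m, k)) :
  \det (A *m B) = \sum_(f : multi_index k m)
    \det (colsub (val f) A) * \det (rowsub (val f) B).
Proof.
have -> : \det (A *m B) = \sum_(f : {ffun 'I_k -> 'I_m})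
    (\prod_i A i (f i)) * \det (rowsub f B).
  pose AB (s : 'S_k) i j := A i j * B j (s i).
  transitivity (\sum_(f : {ffun 'I_k -> 'I_m})
      \sum_(s : 'S_k) (-1) ^+ s * \prod_i AB s i (f i)).
    rewrite exchange_big; apply: eq_bigr => /= s _; rewrite -big_distrr /=.
    congr (_ * _); rewrite -(bigA_distr_bigA (AB s)) /=.
    by apply: eq_bigr => x _; rewrite mxE.
  apply: eq_bigr => f _; rewrite big_distrr /=; apply: eq_bigr => s _.
  rewrite mulrCA big_split //=; congr (_ * (_ * _)).
  by apply: eq_bigr => x _; rewrite mxE.
rewrite (bigID (fun f : {ffun _ -> _} => injectiveb f)) /= addrC big1 ?add0r;
    last first.
  move=> f /injectivePn[i1 [i2 Di12 Ef12]].
  by rewrite (determinant_alternate Di12) ?mulr0 //= => j; rewrite !mxE Ef12.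
pose h (gs : multi_index k m * 'S_k) := [ffun i => val gs.1 (gs.2 i)].
have h_inj : injective h.
  move=> [g s] [g' s'] e.
  have eE i : val g (s i) = val g' (s' i).
    by have /ffunP/(_ i) := e; rewrite !ffunE.
  have gE : g = g'.
    apply: increasing_range_inj => j; apply/codomP/codomP => -[i ->].
      by exists (s' ((s^-1)%g i)); rewrite -eE permKV.
    by exists (s ((s'^-1)%g i)); rewrite eE permKV.
  rewrite gE in eE *; congr (_, _); apply/permP => i.
  exact: increasing_inj (eE i).
rewrite (eq_bigl (fun f => f \in h @: predT)) => [|f]; last first.
  rewrite /=; apply/injectiveP/imsetP => [/sort_injective[g [s ->]]|[[g s] _ ->]].
    by exists (g, s).
  by move=> i j; rewrite !ffunE => /increasing_inj /perm_inj.
rewrite big_imset /=; last by move=> ? ? _ _; exact: h_inj.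
rewrite (eq_bigl predT) => [|x]; last by rewrite inE.
rewrite -(pair_bigA _ (fun g s => (\prod_i A i (h (g, s) i)) *
  \det (rowsub (h (g, s)) B))) /=.
apply: eq_bigr => g _; rewrite big_distrl /=; apply: eq_bigr => s _.
have -> : rowsub (h (g, s)) B = row_perm s (rowsub (val g) B).
  by apply/matrixP => i j; rewrite !mxE ffunE.
rewrite row_permE det_mulmx det_perm mulrCA -[RHS]mulrA.
by congr (_ * (_ * _)); apply: eq_bigr => i _; rewrite !mxE ffunE.
Qed.

(** * Plücker coordinates and Gram determinants *)

Lemma wedge_mul (K : comNzRingType) (k m : nat) (S : 'M[K]_k) (A : 'M[K]_(k, m))
    (f : multi_index k m) : wedge (S *m A) f = \det S * wedge A f.
Proof. by rewrite !ffunE -mulmx_colsub det_mulmx. Qed.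

Lemma wedge_gram (K : comNzRingType) (k m : nat) (A : 'M[K]_(k, m)) :
  \det (A *m A^T) = \sum_f wedge A f ^+ 2.
Proof.
rewrite cauchy_binet; apply: eq_bigr => f _; rewrite ffunE expr2.
by rewrite -[\det (rowsub _ _)]det_tr; congr (_ * \det _); apply/matrixP => i j;
  rewrite !mxE.
Qed.

(** By [cauchy_binet], equal Plücker coordinates give [\det (A *m B) =
\det (A' *m B)] for every [B].  A vector [v] killed by [A] but not by [A']
could be added to the columns of a right inverse [B] of [A] so as to make
[A' *m B] singular while [A *m B] stays the identity. *)
Lemma wedge_inj (F : fieldType) (k m : nat) (A A' : 'M[F]_(k, m)) :
  row_free A -> wedge A = wedge A' -> (A' <= A)%MS.
Proof.
move=> /row_freeP[B AB] wA.
have detE (C : 'M[F]_(m, k)) : \det (A *m C) = \det (A' *m C).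
  rewrite !cauchy_binet; apply: eq_bigr => f _.
  by have /ffunP/(_ f) := wA; rewrite !ffunE => ->.
rewrite submxE; apply/eqP/matrixP => i j.
set v := col j (cokermx A).
have Av : A *m v = 0 by rewrite /v colE mulmxA mulmx_coker mul0mx.
suff u0 : A' *m v = 0.
  have := congr1 (fun M : 'cV[F]_k => M i 0) u0.
  by rewrite /v colE mulmxA -colE !mxE.
have P1 : \det (A' *m B) = 1 by rewrite -detE AB det1.
have Pu : A' *m B \in unitmx by rewrite unitmxE P1 unitr1.
set u := A' *m v; pose x := invmx (A' *m B) *m u.
have [x0|/cV0Pn[l xl]] := eqVneq x 0.
  suff -> : u = A' *m B *m x by rewrite x0 mulmx0.
  exact/esym/(mulKVmx Pu).
(* [r] is chosen so that [x] becomes a null vector of [A' *m (B + v *m r)]. *)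
pose r := - (x l 0)^-1 *: (delta_mx 0 l : 'rV[F]_k).
have rx : r *m x = - 1%:M.
  apply/matrixP => a b; rewrite !ord1 -scalemxAl -rowE !mxE eqxx /= -[1%:R]/1.
  by rewrite mulNr mulVf //; move: xl; rewrite mxE.
have : \det (A' *m (B + v *m r)) = 1.
  by rewrite -detE mulmxDr mulmxA Av mul0mx addr0 AB det1.
have sx : A' *m (B + v *m r) *m x = 0.
  rewrite mulmxDr mulmxDl {1}/x (mulKVmx Pu) mulmxA -/u -mulmxA rx.
  by rewrite mulmxN mulmx1 subrr.
move=> d1; have Qu : A' *m (B + v *m r) \in unitmx by rewrite unitmxE d1 unitr1.
have x0 : x = 0 by rewrite -(mulKmx Qu x) sx mulmx0.
by rewrite x0 mxE eqxx in xl.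
Qed.

Lemma row_free_dsubmx (F : fieldType) (p q m : nat) (A : 'M[F]_(p + q, m)) :
  row_free A -> row_free (dsubmx A).
Proof.
move=> fA; apply: inj_row_free => v vA.
have : row_mx (0 : 'rV[F]_p) v *m A = 0.
  by rewrite -[A]vsubmxK mul_row_col mul0mx vA addr0.
rewrite -(mul0mx _ A) => /(row_free_inj fA) /(congr1 rsubmx).
by rewrite row_mxKr linear0.
Qed.

Section Gram.
Variable R : realFieldType.

Lemma dotvvE (m : nat) (v : 'rV[R]_m) : (v *m v^T) 0 0 = \sum_i v 0 i ^+ 2.
Proof. by rewrite mxE; apply: eq_bigr => i _; rewrite mxE expr2. Qed.

Lemma dotvv_ge0 (m : nat) (v : 'rV[R]_m) : 0 <= (v *m v^T) 0 0.
Proof. by rewrite dotvvE; apply: sumr_ge0 => i _; exact: sqr_ge0. Qed.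

Lemma dotvv_eq0 (m : nat) (v : 'rV[R]_m) : ((v *m v^T) 0 0 == 0) = (v == 0).
Proof.
rewrite dotvvE psumr_eq0 => [|i _]; last exact: sqr_ge0.
apply/allP/eqP => [v0|-> i _]; last by rewrite mxE expr0n eqxx.
apply/rowP => i; rewrite mxE; have := v0 i; rewrite mem_index_enum sqrf_eq0.
by move=> /(_ isT)/eqP.
Qed.

Lemma dotvv_gt0 (m : nat) (v : 'rV[R]_m) : (0 < (v *m v^T) 0 0) = (v != 0).
Proof. by rewrite lt_def dotvv_eq0 dotvv_ge0 andbT. Qed.

Lemma gram_unitmx (k m : nat) (A : 'M[R]_(k, m)) :
  row_free A -> A *m A^T \in unitmx.
Proof.
move=> fA; rewrite -row_free_unit; apply: inj_row_free => v vA.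
apply: (row_free_inj fA); rewrite mul0mx; apply/eqP.
by rewrite -dotvv_eq0 trmx_mul mulmxA -[v *m A *m _]mulmxA vA mul0mx mxE.
Qed.

(** Duality between a subspace and its orthogonal: if the last rows [P'] of [P]
are orthogonal to the columns of [X], the Gram determinants of [P'] and [X]
agree up to the explicit scalars [\det P] and [\det K].  Both sides are read
off from the square matrix [Q] with rows [X^T] and [P'], by multiplying it by
its own transpose and by that of [P]. *)
Lemma gram_dual (p q : nat) (P : 'M[R]_(p + q)) (X : 'M[R]_(p + q, p))
    (K : 'M[R]_p) : P \in unitmx -> P *m X = col_mx K 0 ->
  \det (dsubmx P *m (dsubmx P)^T) * \det K ^+ 2 = \det (X^T *m X) * \det P ^+ 2.
Proof.
move=> Pu PX; set P' := dsubmx P; set G := \det (P' *m _).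
have P'X : P' *m X = 0 by rewrite mul_dsub_mx PX col_mxKd.
have P0X : usubmx P *m X = K by rewrite mul_usub_mx PX col_mxKu.
have XP' : X^T *m P'^T = 0 by rewrite -trmx_mul P'X trmx0.
have G0 : G != 0.
  have fP : row_free P by rewrite row_free_unit.
  by have := gram_unitmx (row_free_dsubmx fP); rewrite unitmxE unitfE.
pose Q := col_mx X^T P'.
have QQ : \det Q ^+ 2 = \det (X^T *m X) * G.
  rewrite expr2 -{2}det_tr -det_mulmx /Q tr_col_mx mul_col_row trmxK XP' P'X.
  by rewrite det_ublock.
have QP : \det Q * \det P = \det K * G.
  rewrite -(det_tr P) -det_mulmx /Q -{1}[P]vsubmxK tr_col_mx mul_col_row XP'.
  by rewrite det_lblock -trmx_mul P0X det_tr.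
apply: (mulfI G0); transitivity ((\det K * G) ^+ 2); first by ring.
by rewrite -QP exprMn QQ; ring.
Qed.

End Gram.

(** * Orthonormal bases *)

Section Orthonormal.

Variable R : rcfType.

Lemma gram_schmidt (k m : nat) (A : 'M[R]_(k, m)) : row_free A ->
  exists (S : 'M[R]_k) (F : 'M[R]_(k, m)),
    [/\ A = S *m F, F *m F^T = 1%:M & S \in unitmx].
Proof.
elim: k A => [|k IHk] A fA.
  exists 1%:M, A; rewrite mul1mx unitmx1; split=> //.
  by apply/matrixP => -[].
rewrite -[k.+1]/(1 + k)%N in A fA *; rewrite -[A]vsubmxK in fA *.
set a := usubmx A in fA *; set A' := dsubmx A in fA *.
have fA' : row_free A' by have := row_free_dsubmx fA; rewrite col_mxKd.
have [S' [F' [A'E F'F' S'u]]] := IHk A' fA'.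
pose r := a - a *m F'^T *m F'.
have r0 : r != 0.
  apply/negP => /eqP/subr0_eq aE.
  have : row_mx (1%:M : 'M[R]_1) (- (a *m F'^T *m invmx S')) *m col_mx a A' = 0.
    rewrite mul_row_col mul1mx mulNmx A'E -[_ *m invmx S' *m _]mulmxA.
    by rewrite (mulKmx S'u) -aE subrr.
  rewrite -(mul0mx _ (col_mx a A')) => /(row_free_inj fA) /(congr1 lsubmx).
  rewrite row_mxKl linear0 => /matrixP/(_ 0 0); rewrite !mxE => /eqP.
  by rewrite oner_eq0.
have rF' : r *m F'^T = 0.
  by rewrite mulmxBl -!mulmxA F'F' mulmx1 subrr.
pose rho := Num.sqrt ((r *m r^T) 0 0).
have rho0 : rho != 0 by rewrite gt_eqF // sqrtr_gt0 dotvv_gt0.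
have rr : r *m r^T = (rho ^+ 2)%:M.
  by rewrite [LHS]mx11_scalar sqr_sqrtr // dotvv_ge0.
exists (block_mx rho%:M (a *m F'^T) 0 S'), (col_mx (rho^-1 *: r) F'); split.
- rewrite /block_mx mul_col_mx !mul_row_col mul0mx add0r -A'E mul_scalar_mx.
  by rewrite scalerA divff // scale1r /r subrK.
- rewrite tr_col_mx mul_col_row F'F' linearZ /= -scalemxAl -scalemxAr rr.
  rewrite -scalemxAl rF' scaler0 -scalemxAr -[F' *m r^T]trmxK trmx_mul trmxK.
  rewrite rF' trmx0 scaler0 scalerA [RHS]scalar_mx_block; congr (block_mx _ _ _ _).
  by rewrite scale_scalar_mx; congr (_%:M); field.
- by rewrite unitmxE det_ublock det_scalar1 unitrM unitfE rho0 -unitmxE.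
Qed.

(** The reflection in the bisecting hyperplane of [s] and its image. *)
Lemma rotate_to_axis (d : nat) (s : 'rV[R]_(1 + d)) :
  exists O : 'M[R]_(1 + d), O *m O^T = 1%:M /\
    s *m O = row_mx (Num.sqrt ((s *m s^T) 0 0))%:M 0.
Proof.
set sg := Num.sqrt _; set e : 'rV[R]_(1 + d) := row_mx _ 0.
have ss : s *m s^T = (sg ^+ 2)%:M.
  by rewrite [LHS]mx11_scalar sqr_sqrtr // dotvv_ge0.
have ee : e *m e^T = (sg ^+ 2)%:M.
  rewrite /e tr_row_mx mul_row_col trmx0 mulmx0 addr0 tr_scalar_mx.
  by rewrite -scalar_mxM expr2.
have [v0|v0] := eqVneq (s - e) 0.
  by exists 1%:M; rewrite trmx1 !mulmx1; split => //; apply/subr0_eq.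
have [v vE] : exists v, v = s - e by exists (s - e).
rewrite -vE in v0; pose q := (v *m v^T) 0 0; pose c := 2 / q.
have q0 : q != 0 by rewrite dotvv_eq0.
have vv : v *m v^T = q%:M by rewrite [LHS]mx11_scalar.
pose t := (s *m v^T) 0 0.
have sv : s *m v^T = t%:M by rewrite [LHS]mx11_scalar.
have qt : q = 2 * t.
  have se : (e *m s^T) 0 0 = (s *m e^T) 0 0.
    by rewrite -[e *m s^T]trmxK trmx_mul trmxK mxE.
  rewrite /q /t vE linearB /= mulmxBl !mulmxBr ss ee !mxE -/(GRing.exp _ _).
  by move: se; rewrite !mxE => ->; ring.
have t0 : t != 0 by apply: contraNneq q0 => t0; rewrite qt t0 mulr0.
pose O := 1%:M - c *: (v^T *m v).
have OT : O^T = O by rewrite /O linearB linearZ /= trmx_mul trmxK trmx1.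
exists O; rewrite OT; split.
  have ww : v^T *m v *m (v^T *m v) = q *: (v^T *m v).
    by rewrite -mulmxA [v *m (_ *m v)]mulmxA vv mul_scalar_mx -scalemxAr.
  rewrite /O mulmxBl mul1mx mulmxBr mulmx1 -scalemxAl -scalemxAr ww !scalerA.
  have -> : c * c * q = c + c by rewrite /c; field.
  by rewrite scalerDl opprB addrK subrK.
rewrite /O mulmxBr mulmx1 -scalemxAr mulmxA sv mul_scalar_mx scalerA.
have -> : c * t = 1 by rewrite /c qt; field.
by rewrite scale1r vE subKr.
Qed.

End Orthonormal.

(** * Geometry of numbers *)

Lemma abs_det_unitmx (k : nat) (P : 'M[int]_k) :
  P \in unitmx -> `|\det P|%N = 1%N.
Proof. by rewrite unitmxE qualifE /= => /orP[] /eqP ->. Qed.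

Lemma sqr_det_unitmx (k : nat) (P : 'M[int]_k) :
  P \in unitmx -> \det P ^+ 2 = 1.
Proof.
by rewrite unitmxE qualifE /= => /orP[] /eqP ->; rewrite ?sqrrN expr1n.
Qed.

Lemma unitmx_intr (F : fieldType) (k : nat) (P : 'M[int]_k) :
  P \in unitmx -> (map_mx intr P : 'M[F]_k) \in unitmx.
Proof. by rewrite !unitmxE det_map_mx; exact: rmorph_unit. Qed.

(** The lattice spanned by the rows of [M] has index [`|\det M|] in the lattice
of all integer vectors, by the Smith normal form; so two points of a box with
more than [`|\det M|] points differ by a vector of that lattice. *)
Lemma short_vector_int (k s : nat) (M : 'M[int]_k) :
  \det M != 0 -> (`|\det M| < s ^ k)%N ->
  exists2 e : 'rV[int]_k, e != 0 & forall j, (`|(e *m M) ord0 j| < s)%N.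
Proof.
have [L Lu [U Uu [d _ ME]]] := int_Smith_normal_form M.
set D := \matrix_(i, j) _ in ME.
have DE : D = diag_mx (\row_i d`_i).
  by apply/matrixP => i j; rewrite !mxE.
have dM : `|\det M|%N = (\prod_(i < k) `|(d`_i)%R|)%N.
  rewrite ME !det_mulmx !abszM (abs_det_unitmx Lu) (abs_det_unitmx Uu).
  rewrite mul1n muln1 DE det_diag.
  rewrite (big_morph absz abszM (erefl _)).
  by apply: eq_bigr => i _; rewrite mxE.
move=> M0 sM.
have d0 (i : 'I_k) : d`_i != 0.
  apply: contraNneq M0 => di0.
  by rewrite -absz_eq0 dM (bigD1 i) //= di0 mul0n.
pose pt (b : {ffun 'I_k -> 'I_s}) : 'rV[int]_k := \row_j (b j : nat)%:Z.
pose w b := pt b *m invmx U.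
have ltd b (i : 'I_k) : (`|(w b ord0 i %% (d`_i)%R)%Z| < `|(d`_i)%R|)%N.
  by rewrite -ltz_nat gez0_abs ?modz_ge0 // ltz_mod.
pose cls b : {dffun forall i : 'I_k, 'I_(`|(d`_i)%R|)} :=
  [ffun i : 'I_k => Ordinal (ltd b i)].
have /injectivePn[b [b' bb' cbb']] : ~~ injectiveb cls.
  apply/negP => /injectiveP /leq_card; rewrite card_ffun !card_ord leqNgt.
  rewrite card_dep_ffun foldrE big_image /=.
  by under eq_bigr do rewrite card_ord; rewrite -dM sM.
have dvd i : ((d`_i)%R %| (w b - w b')%R ord0 i)%Z.
  have /ffunP/(_ i) := cbb'; rewrite !ffunE => /(congr1 val) /= e.
  rewrite !mxE -eqz_mod_dvd; apply/eqP.
  rewrite -[LHS]gez0_abs ?modz_ge0 // -[RHS]gez0_abs ?modz_ge0 //.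
  by move: e; rewrite !mxE => ->.
pose q : 'rV[int]_k := \row_i ((w b - w b')%R ord0 i %/ (d`_i)%R)%Z.
have qD : q *m D = w b - w b'.
  apply/rowP => j; rewrite DE mul_mx_diag !mxE.
  by have := divzK (dvd j); rewrite !mxE.
have eM : q *m invmx L *m M = pt b - pt b'.
  rewrite ME -!mulmxA mulKmx // mulmxA qD mulmxBl /w.
  by rewrite !mulmxKV.
exists (q *m invmx L) => [|j].
  apply: contraNneq bb' => e0; move: eM; rewrite e0 mul0mx => /esym/subr0_eq.
  move=> /rowP bE; apply/eqP/ffunP => i; apply/val_inj.
  by have := bE i; rewrite !mxE => -[].
rewrite eM !mxE; have := ltn_ord (b j); have := ltn_ord (b' j).
move: (nat_of_ord (b j)) (nat_of_ord (b' j)) => x y. lia.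
Qed.

Section Minkowski.

Variable R : realType.

(** The entries of [F] are so small that [u *m F] is at most half of [u] in sup
norm. *)
Lemma near_identity_bound (k : nat) (F : 'M[R]_k) (u : 'rV[R]_k) (t : R) :
  0 <= t -> (forall i j, `|F i j| <= (2 * k%:R)^-1) ->
  (forall j, `|(u *m (1%:M + F)) 0 j| <= t) -> forall j, `|u 0 j| <= 2 * t.
Proof.
move=> t0 Fle ule j.
have [j0 _ j0max] := @Order.TotalTheory.arg_maxP _ _ _ j xpredT (fun j => `|u 0 j|) isT.
apply: le_trans (j0max j isT) _.
have k0 : (0 : R) < k%:R by rewrite ltr0n (leq_ltn_trans _ (ltn_ord j)).
have : `|u 0 j0| <= t + `|u 0 j0| / 2; last by lra.
have uE : u 0 j0 = (u *m (1%:M + F)) 0 j0 - \sum_i u 0 i * F i j0.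
  by rewrite mulmxDr mulmx1 [in RHS]mxE [X in _ + X - _]mxE addrK.
rewrite {1}uE (le_trans (ler_normB _ _)) // lerD //.
rewrite (le_trans (ler_norm_sum _ _ _)) //.
have -> : `|u 0 j0| / 2 = \sum_(i < k) `|u 0 j0| * (2 * k%:R)^-1.
  by rewrite sumr_const card_ord -mulr_natr; field; rewrite gt_eqF.
apply: ler_sum => i _; rewrite normrM ler_pM //; exact: j0max.
Qed.

Lemma det_bound (k : nat) (A : 'M[R]_k) (t : R) :
  (forall i j, `|A i j| <= t) -> `|\det A| <= k`!%:R * t ^+ k.
Proof.
move=> Ale; rewrite (le_trans (ler_norm_sum _ _ _)) //.
have -> : k`!%:R * t ^+ k = \sum_(s : 'S_k) t ^+ k.
  by rewrite mulr_natl sumr_const -card_Sn.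
apply: ler_sum => s _; rewrite normrM normrX normrN1 expr1n mul1r normr_prod.
rewrite -[in leRHS](card_ord k) -prodr_const.
by apply: ler_prod => i _; rewrite normr_ge0 Ale.
Qed.

(** Minkowski's theorem on linear forms, with an unspecified constant.  The
forms are approximated by forms with rational coefficients of a large common
denominator [q], for which the problem is [short_vector_int]; the error is
absorbed as [M = q B (1 + F)] with [F] small. *)
Lemma minkowski_linear_forms (k : nat) :
  exists2 C : R, 1 <= C & forall B : 'M[R]_k, (0 < k)%N ->
    B \in unitmx -> `|\det B| <= 1 ->
    exists2 c : 'rV[int]_k, c != 0 &
      forall j, `|(map_mx intr c *m B) 0 j| <= C.
Proof.
pose K := (k`! * 2 ^ k)%N; exists (2 * K%:R).
  have : (1 <= K%:R :> R) by rewrite ler1n muln_gt0 fact_gt0 expn_gt0.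
  by lra.
move=> B k0 Bu B1.
have kR : 1 <= k%:R :> R by rewrite ler1n.
pose T := \sum_i \sum_j `|invmx B i j|.
have T0 : 0 <= T by do 2![apply: sumr_ge0 => ? _].
pose q := (Num.truncn (T * (2 * k%:R))).+1.
have qT : T * (2 * k%:R) <= q%:R by rewrite ltW // truncnS_gt.
have q0 : 0 < q%:R :> R by rewrite ltr0n.
pose M : 'M[int]_k := map_mx (fun r => Num.floor (q%:R * r)) B.
pose E : 'M[R]_k := map_mx intr M - q%:R *: B.
have E1 i j : `|E i j| <= 1.
  rewrite !mxE ler_norml; have := Num.Theory.floor_itv (q%:R * B i j).
  by rewrite intrD => /andP[]; lra.
pose F := q%:R^-1 *: (invmx B *m E).
have FE i j : `|F i j| <= (2 * k%:R)^-1.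
  rewrite mxE normrM normfV (gtr0_norm q0) ler_pdivrMl //.
  have : `|(invmx B *m E) i j| <= T.
    rewrite mxE (le_trans (ler_norm_sum _ _ _)) //.
    rewrite [leRHS](bigD1 i) //= ler_wpDr //; first by do 2![apply: sumr_ge0 => ? _].
    by apply: ler_sum => l _; rewrite normrM ler_piMr.
  by move=> /le_trans; apply; rewrite ler_pdivlMr //; lra.
have ME : map_mx intr M = q%:R *: (B *m (1%:M + F)).
  rewrite mulmxDr mulmx1 /F -scalemxAr mulKVmx // scalerDr scalerA divff ?gt_eqF //.
  by rewrite scale1r /E addrC subrK.
have Fu : 1%:M + F \in unitmx.
  rewrite -row_free_unit; apply: inj_row_free => v vF; apply/rowP => j.
  rewrite mxE; apply/eqP; rewrite -normr_le0.
  have := near_identity_bound (lexx 0) FE; move=> /(_ v); rewrite vF mulr0.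
  by apply=> i; rewrite mxE normr0.
have detF : `|\det (1%:M + F)| <= K%:R.
  rewrite natrM natrX; apply: det_bound => i j; rewrite mxE.
  rewrite (le_trans (ler_normD _ _)) //.
  have -> : 2 = 1 + 1 :> R by [].
  apply: lerD; first by rewrite mxE; case: eqP => _; rewrite ?normr1 ?normr0 ?ler01.
  by rewrite (le_trans (FE i j)) // invf_le1; lra.
have detM : `|\det M|%:~R <= q%:R ^+ k * K%:R :> R.
  rewrite intr_norm -det_map_mx ME detZ det_mulmx !normrM normrX gtr0_norm //.
  by rewrite ler_pM2l ?exprn_gt0 // -[leRHS]mul1r ler_pM.
have [||c c0 cM] := @short_vector_int k (q * K).+1 M.
- rewrite -(intr_eq0 R) -det_map_mx ME detZ det_mulmx mulf_neq0 //.
    by rewrite expf_neq0 // gt_eqF.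
  by rewrite -unitfE unitrM -!unitmxE Bu.
- rewrite -(ltr_nat R) (@le_lt_trans _ _ (q%:R ^+ k * K%:R)) //.

  rewrite -natrX -natrM ltr_nat (@leq_ltn_trans ((q * K) ^ k)%N) //.
    have K0 : (0 < K)%N by rewrite muln_gt0 fact_gt0 expn_gt0.
    by rewrite expnMn leq_mul2l -[leqLHS]expn1 leq_pexp2l ?orbT.
  by rewrite ltn_exp2r.
exists c => //; apply: near_identity_bound FE _; first by rewrite ler0n.
move=> j; have := cM j; rewrite ltnS -(ler_nat R) natr_absz intr_norm.
have -> : ((c *m M) 0 j)%:~R = (map_mx intr c *m map_mx intr M) 0 j :> R.
  by rewrite -map_mxM [RHS]mxE.
rewrite ME -scalemxAr mxE mulmxA normrM gtr0_norm // natrM.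
by rewrite ler_pM2l.
Qed.

End Minkowski.

(** In the Smith normal form of [N] the divisibility chain puts the non-zero
invariants first, so only the first [l] rows of the diagonal matrix can be
non-zero; the other rows of the inverse of the left factor kill [N]. *)
Lemma unimodular_kernel (F : numFieldType) (l k q : nat)
    (N : 'M[int]_(l + k, q)) :
  \rank (map_mx intr N : 'M[F]_(l + k, q)) = l ->
  exists2 P : 'M[int]_(l + k), P \in unitmx & dsubmx P *m N = 0.
Proof.
have [L Lu [U Uu [d dS NE]]] := int_Smith_normal_form N.
set D := \matrix_(i, j) _ in NE.
move=> rN; exists (invmx L); first by rewrite unitmx_inv.
rewrite mul_dsub_mx NE -mulmxA mulKmx // -mul_dsub_mx.
suff -> : dsubmx D = 0 by rewrite mul0mx.
apply/matrixP => i j; rewrite !mxE /=; have [ij|] := eqVneq (l + i)%N j; last by [].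
apply/eqP; rewrite mulr1n; apply/idPn => di.
have ltd : (l + i < size d)%N.
  by rewrite ltnNge; apply: contra di => /(nth_default 0) ->.
have dn (a : nat) : (a <= l + i)%N -> d`_a != 0.
  move=> ale; apply: contra di => /eqP da.
  have := sorted_leq_nth dvdz_trans dvdzz 0 dS.
  move=> /(_ a (l + i)%N); rewrite !inE ltd (leq_ltn_trans ale ltd) ale da.
  by move=> /(_ isT isT isT); rewrite dvd0z.
have lek : ((l + i).+1 <= l + k)%N by rewrite -addnS leq_add2l.
pose DF : 'M[F]_(l + k, q) := map_mx intr D.
have : row_free (rowsub (widen_ord lek) DF).
  apply: inj_row_free => v vD; apply/rowP => a.
  have aq : (a < q)%N by rewrite (leq_trans (ltn_ord a)) // ij.
  have := congr1 (fun M : 'rV[F]_q => M 0 (Ordinal aq)) vD.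
  rewrite !mxE (bigD1 a) //= big1 => [|b ba]; last first.
    by rewrite !mxE /= (inj_eq val_inj) (negPf ba) mulr0n mulr0.
  rewrite !mxE /= eqxx mulr1n addr0 => /eqP; rewrite mulf_eq0 intr_eq0.
  by rewrite (negPf (dn _ _)) ?orbF -1?ltnS // => /eqP.
rewrite /row_free => /eqP rD.
have : (\rank (rowsub (widen_ord lek) DF) <= \rank DF)%N.
  by apply: mxrankS; exact: rowsub_sub.
rewrite rD; have -> : \rank DF = l; last by lia.
rewrite -[RHS]rN NE !map_mxM -/DF mxrankMfree.
  by rewrite eqmxMfull // row_full_unit unitmx_intr.
by rewrite row_free_unit unitmx_intr.
Qed.

(** * Euclidean norm and projective distance *)

Section Distance.

Variable R : realType.

Definition dot (m : nat) (x y : 'rV[R]_m) : R := (x *m y^T) 0 0.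
Definition enorm (m : nat) (x : 'rV[R]_m) : R := l2norm (x 0).

Lemma dotC (m : nat) (x y : 'rV[R]_m) : dot x y = dot y x.
Proof. by rewrite /dot -[x *m _]trmxK trmx_mul trmxK mxE. Qed.

Lemma dotDl (m : nat) (x y z : 'rV[R]_m) : dot (x + y) z = dot x z + dot y z.
Proof. by rewrite /dot mulmxDl mxE. Qed.

Lemma dotZl (m : nat) (a : R) (x y : 'rV[R]_m) : dot (a *: x) y = a * dot x y.
Proof. by rewrite /dot -scalemxAl mxE. Qed.

Lemma dotDr (m : nat) (x y z : 'rV[R]_m) : dot z (x + y) = dot z x + dot z y.
Proof. by rewrite !(dotC z) dotDl. Qed.

Lemma dotZr (m : nat) (a : R) (x y : 'rV[R]_m) : dot x (a *: y) = a * dot x y.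
Proof. by rewrite !(dotC x) dotZl. Qed.

Lemma dotNl (m : nat) (x y : 'rV[R]_m) : dot (- x) y = - dot x y.
Proof. by rewrite -scaleN1r dotZl mulN1r. Qed.

Lemma dotNr (m : nat) (x y : 'rV[R]_m) : dot x (- y) = - dot x y.
Proof. by rewrite !(dotC x) dotNl. Qed.

Definition dotE := (dotDl, dotDr, dotNl, dotNr, dotZl, dotZr).

Lemma enorm_ge0 (m : nat) (x : 'rV[R]_m) : 0 <= enorm x.
Proof. exact: sqrtr_ge0. Qed.

Lemma sqr_enorm (m : nat) (x : 'rV[R]_m) : enorm x ^+ 2 = dot x x.
Proof.
by rewrite sqr_sqrtr ?sumr_ge0 // => [|i _]; rewrite ?sqr_ge0 // /dot dotvvE.
Qed.

Lemma enormE (m : nat) (x : 'rV[R]_m) : enorm x = Num.sqrt (dot x x).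
Proof. by rewrite -sqr_enorm sqrtr_sqr ger0_norm ?enorm_ge0. Qed.

Lemma enorm_gt0 (m : nat) (x : 'rV[R]_m) : (0 < enorm x) = (x != 0).
Proof. by rewrite enormE sqrtr_gt0 dotvv_gt0. Qed.

Lemma enorm0 (m : nat) : enorm (0 : 'rV[R]_m) = 0.
Proof. by apply/eqP; rewrite eq_le enorm_ge0 leNgt enorm_gt0 eqxx. Qed.

Lemma enormZ (m : nat) (a : R) (x : 'rV[R]_m) : enorm (a *: x) = `|a| * enorm x.
Proof.
by rewrite !enormE !dotE mulrA -expr2 sqrtrM ?sqr_ge0 // sqrtr_sqr.
Qed.

Lemma enormN (m : nat) (x : 'rV[R]_m) : enorm (- x) = enorm x.
Proof. by rewrite !enormE !dotE opprK. Qed.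

Lemma sqr_l2norm_wedge (k m : nat) (A : 'M[R]_(k, m)) :
  l2norm (wedge A) ^+ 2 = \det (A *m A^T).
Proof.
by rewrite wedge_gram sqr_sqrtr // sumr_ge0 // => f _; exact: sqr_ge0.
Qed.

Lemma det_gram2 (m : nat) (x y : 'rV[R]_m) :
  \det (col_mx x y *m (col_mx x y)^T) = dot x x * dot y y - dot x y ^+ 2.
Proof.
rewrite tr_col_mx mul_col_row [x *m x^T]mx11_scalar [x *m y^T]mx11_scalar.
rewrite [y *m x^T]mx11_scalar [y *m y^T]mx11_scalar -!/(dot _ _) (dotC y x).
rewrite (expand_det_row _ (lshift 1 ord0)) big_split_ord !big_ord1.
have minorE (M : 'M[R]_(1 + 1)) i j :
    row' i (col' j M) 0 0 = M (lift i 0) (lift j 0) by rewrite !mxE.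
rewrite block_mxEul block_mxEur /cofactor !det_mx11 !minorE.
have -> : lift (lshift 1 0 : 'I_(1 + 1)) (0 : 'I_1) = rshift 1 0.
  exact: val_inj.
have -> : lift (rshift 1 0 : 'I_(1 + 1)) (0 : 'I_1) = lshift 1 0.
  exact: val_inj.
by rewrite block_mxEdl block_mxEdr !mxE /=; ring.
Qed.

Lemma cauchy_schwarz_sqr (m : nat) (x y : 'rV[R]_m) :
  dot x y ^+ 2 <= dot x x * dot y y.
Proof. by rewrite -subr_ge0 -det_gram2 -sqr_l2norm_wedge sqr_ge0. Qed.

Lemma cauchy_schwarz (m : nat) (x y : 'rV[R]_m) :
  `|dot x y| <= enorm x * enorm y.
Proof.
rewrite !enormE -sqrtrM ?dotvv_ge0 // -sqrtr_sqr ler_sqrt ?cauchy_schwarz_sqr //.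
by rewrite mulr_ge0 ?dotvv_ge0.
Qed.

Lemma enormD (m : nat) (x y : 'rV[R]_m) : enorm (x + y) <= enorm x + enorm y.
Proof.
rewrite -(@ler_pXn2r _ 2) ?nnegrE ?addr_ge0 ?enorm_ge0 //.
rewrite sqrrD !sqr_enorm !dotE (dotC y x).
have := le_trans (ler_norm _) (cauchy_schwarz x y); lra.
Qed.

Lemma pdistE (m : nat) (x y : 'rV[R]_m) :
  pdist x y = l2norm (wedge (col_mx x y)) / (enorm x * enorm y).
Proof. by []. Qed.

Lemma pdist_ge0 (m : nat) (x y : 'rV[R]_m) : 0 <= pdist x y.
Proof. by rewrite divr_ge0 ?mulr_ge0 ?sqrtr_ge0. Qed.

Lemma pdist_le (m : nat) (x y : 'rV[R]_m) : x != 0 -> y != 0 ->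
  pdist x y <= enorm (x - y) / enorm x.
Proof.
rewrite -!enorm_gt0 => x0 y0; rewrite pdistE ler_pdivrMr ?mulr_gt0 //.
rewrite mulrA divfK ?gt_eqF //.
rewrite -(@ler_pXn2r _ 2) ?nnegrE ?mulr_ge0 ?sqrtr_ge0 //.
rewrite sqr_l2norm_wedge det_gram2 exprMn !sqr_enorm !dotE (dotC y x).
rewrite -subr_ge0.
apply: le_trans (sqr_ge0 (dot y y - dot x y)) _.
by rewrite le_eqVlt; apply/orP; left; apply/eqP; ring.
Qed.

Lemma pdist_projection (m : nat) (x y : 'rV[R]_m) : x != 0 -> y != 0 ->
  enorm (x - (dot x y / dot y y) *: y) = pdist x y * enorm x.
Proof.
move=> x0 y0; apply/eqP; have p0 := mulr_ge0 (pdist_ge0 x y) (enorm_ge0 x).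
rewrite -(@eqrXn2 _ 2) ?enorm_ge0 //.
rewrite exprMn pdistE expr_div_n exprMn sqr_l2norm_wedge det_gram2 !sqr_enorm.
rewrite !dotE (dotC y x); apply/eqP.
have xx : dot x x != 0 by rewrite dotvv_eq0.
have yy : dot y y != 0 by rewrite dotvv_eq0.
by field; rewrite xx yy.
Qed.

Section Subspace.

Variables (m : nat) (x : 'rV[R]_m) (V : {vspace 'rV[R]_m}).
Hypothesis x0 : x != 0.

Let S := [set pdist x y | y in [set y : 'rV[R]_m | y \in V /\ y != 0]]%classic.

Let S_lb : has_lbound S.
Proof. by exists 0 => _ [y _ <-]; exact: pdist_ge0. Qed.

(** Together with [pdist_sub_approx], this replaces the projective distance to
[V] by the Euclidean distance from [x] to points of [V], for which the triangle
inequality is available. *)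
Lemma pdist_sub_le (y : 'rV[R]_m) : y \in V -> y != 0 ->
  pdist_sub x V <= enorm (x - y) / enorm x.
Proof.
move=> yV y0; apply: le_trans (pdist_le x0 y0).
by apply: ge_inf => //; exists y.
Qed.

Lemma pdist_sub_approx (delta : R) : V != 0%VS -> pdist_sub x V < delta ->
  exists2 y, y \in V & enorm (x - y) <= delta * enorm x.
Proof.
move=> V0 /inf_lt[|_ [y [yV y0] <-] yd].
  exists (pdist x (vpick V)), (vpick V) => //.
  by split; rewrite ?memv_pick ?vpick0.
exists ((dot x y / dot y y) *: y); first exact: memvZ.
by rewrite pdist_projection // ler_wpM2r ?enorm_ge0 // ltW.
Qed.

End Subspace.

End Distance.

(** * Integral bases and heights of rational subspaces *)

Section RowSpace.

Variables (R : fieldType) (m : nat).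

Definition row_space_of (k : nat) (A : 'M[R]_(k, m)) (V : {vspace 'rV[R]_m}) :=
  forall v : 'rV[R]_m, (v \in V) = (v <= A)%MS.

Lemma mem_span_rows (s : seq 'rV[R]_m) :
  row_space_of (\matrix_(i < size s) s`_i) (span s).
Proof.
move=> v; apply/idP/idP => [vs|/submxP[u ->]].
  rewrite (@coord_span _ _ _ (in_tuple s) v) //.
  apply: summx_sub => i _; apply: scalemx_sub.
  by rewrite -[_`_i](rowK (fun i : 'I_(size s) => s`_i)) row_sub.
rewrite mulmx_sum_row; apply: memv_suml => i _; apply: memvZ.
by rewrite rowK memv_span // mem_nth.
Qed.

Lemma row_space_exists (k : nat) (A : 'M[R]_(k, m)) :
  row_space_of A <<[seq row i A | i <- enum 'I_k]>>%VS.
Proof.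
move=> v; rewrite mem_span_rows; set M := \matrix_(i < _) _.
suff /eqmxP AM : (M == A)%MS by rewrite AM.
have sz : size [seq row i A | i <- enum 'I_k] = k by rewrite size_map size_enum_ord.
apply/andP; split; apply/row_subP => i.
  rewrite rowK; have /mapP[j _ ->] : [seq row i A | i <- enum 'I_k]`_i \in
    [seq row i A | i <- enum 'I_k] by rewrite mem_nth.
  exact: row_sub.
have -> : row i A = row (cast_ord (esym sz) i) M.
  by rewrite rowK (nth_map i) ?size_enum_ord //= nth_ord_enum.
exact: row_sub.
Qed.

Lemma row_space_inj (k k' : nat) (A : 'M[R]_(k, m)) (A' : 'M[R]_(k', m)) V V' :
  row_space_of A V -> row_space_of A' V' -> (A :=: A')%MS -> V = V'.
Proof. by move=> VA VA' AA'; apply/vspaceP => v; rewrite VA VA' AA'. Qed.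

Lemma row_space_eqmx (k k' : nat) (A : 'M[R]_(k, m)) (A' : 'M[R]_(k', m)) V :
  row_space_of A V -> row_space_of A' V -> (A :=: A')%MS.
Proof.
move=> VA VA'; apply/eqmxP/andP.
by split; apply/row_subP => i; [rewrite -VA' VA | rewrite -VA VA']; exact: row_sub.
Qed.

Lemma dim_row_free (k : nat) (A : 'M[R]_(k, m)) V :
  row_free A -> row_space_of A V -> \dim V = k.
Proof.
move=> fA VA; have -> : V = <<[seq row i A | i <- enum 'I_k]>>%VS.
  exact: (row_space_inj VA (row_space_exists A)).
pose t := [tuple row i A | i < k].
have tE (i : 'I_k) : t`_i = row i A by rewrite -tnth_nth tnth_mktuple.
have /eqP -> : free t; last by rewrite size_tuple.
apply/freeP => c cA i.
have : \row_i c i *m A = 0 *m A.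
  rewrite mul0mx -[RHS]cA mulmx_sum_row; apply: eq_bigr => j _.
  by rewrite mxE tE.
by move=> /(row_free_inj fA) /rowP/(_ i); rewrite !mxE.
Qed.

Lemma dim_row_space (k : nat) (A : 'M[R]_(k, m)) V :
  row_space_of A V -> \dim V = \rank A.
Proof.
move=> VA; apply: (dim_row_free (row_base_free A)) => v.
by rewrite VA eq_row_base.
Qed.

Lemma vbasis_row_space (V : {vspace 'rV[R]_m}) :
  row_space_of (\matrix_(i < \dim V) tnth (vbasis V) i) V.
Proof.
have := row_space_exists (\matrix_(i < \dim V) tnth (vbasis V) i).
suff -> : [seq row i (\matrix_(i < \dim V) tnth (vbasis V) i) |
    i <- enum 'I_(\dim V)] = vbasis V by rewrite (span_basis (vbasisP V)).
rewrite -[RHS]map_tnth_enum; apply: eq_map => i; exact: rowK.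
Qed.

End RowSpace.

Section Height.

Variable R : realType.

Local Notation toR := (map_mx (intr : int -> R)).

Lemma wedge_intr (k m : nat) (A : 'M[int]_(k, m)) f :
  wedge (toR A) f = (wedge A f)%:~R.
Proof.
rewrite !ffunE -det_map_mx; congr (\det _).
by apply/matrixP => i j; rewrite !mxE.
Qed.

Lemma rational_row_space (k m : nat) (A : 'M[int]_(k, m)) V :
  row_space_of (toR A) V -> rational_sub V.
Proof.
move=> VA; exists [seq row i (map_mx intr A) | i <- enum 'I_k].
rewrite -map_comp (@eq_map _ _ _ (fun i => row i (toR A))) => [|i]; last first.
  by apply/rowP => j; rewrite !mxE ratr_int.
exact: row_space_inj VA (row_space_exists _) (eqmx_refl _).
Qed.

Lemma row_free_right_inverse (k m : nat) (A : 'M[int]_(k, m))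
    (B : 'M[int]_(m, k)) :
  A *m B = 1%:M -> row_free (toR A).
Proof.
by move=> AB; apply/row_freeP; exists (toR B); rewrite -map_mxM AB map_mx1.
Qed.

(** The minors of a basis of the lattice of integer points of [V] are coprime:
expanding [A *m B = 1] by [cauchy_binet] writes [1] as a combination of them.
They are proportional to the minors of any other basis of [V]. *)
Lemma height_basis (k m : nat) (A : 'M[int]_(k, m)) (B : 'M[int]_(m, k))
    (V : {vspace 'rV[R]_m}) :
  A *m B = 1%:M -> row_space_of (toR A) V -> height V = l2norm (wedge (toR A)).
Proof.
move=> AB VA; have fA := row_free_right_inverse AB.
have dV := dim_row_free fA VA; subst k.
pose Bv := \matrix_(i < \dim V) tnth (vbasis V) i.
have [K AE] : exists K, toR A = K *m Bv.
  by apply/submxP; rewrite (row_space_eqmx VA (@vbasis_row_space _ _ V)).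
have -> : height V = l2norm (fun f => (wedge A f)%:~R : R).
  apply: heightE; split.
    exists (\det K) => [|f]; last by rewrite -wedge_intr AE wedge_mul.
    rewrite -unitfE -unitmxE -row_free_unit; apply: inj_row_free => v vK.
    by apply: (row_free_inj fA); rewrite AE mulmxA vK !mul0mx.
  apply/eqP; rewrite -dvdn1; set g := (\big[_/_]_f _)%N.
  have : (g%:Z %| \det (A *m B))%Z.
    rewrite cauchy_binet; apply: rpred_sum => f _; apply: dvdz_mulr.
    have : (g %| `|wedge A f|)%N by rewrite /g (bigD1 f) //= dvdn_gcdl.
    by rewrite ffunE.
  by rewrite AB det1.
by congr Num.sqrt; apply: eq_bigr => f _; rewrite wedge_intr.
Qed.

Lemma clear_denominators (p q : nat) (C : 'M[rat]_(p, q)) :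
  exists2 D : int, D != 0 & exists N : 'M[int]_(p, q), D%:~R *: C = map_mx intr N.
Proof.
pose D := \prod_(ij : 'I_p * 'I_q) denq (C ij.1 ij.2).
exists D; first by apply/prodf_neq0 => ij _; exact: denq_neq0.
exists (\matrix_(i, j) (numq (C i j) * \prod_(ij | ij != (i, j)) denq (C ij.1 ij.2))).
apply/matrixP => i j; rewrite !mxE /D (bigD1 (i, j)) //= !intrM.
by rewrite mulrAC [_ * C i j]mulrC -numqE.
Qed.

(** The equations of [V] are the columns of [cokermx], cleared of their
denominators. *)
Lemma rational_kernel (m : nat) (V : {vspace 'rV[R]_m}) : rational_sub V ->
  exists N : 'M[int]_m, forall v, (v \in V) = (v *m toR N == 0).
Proof.
move=> [X ->]; pose M := \matrix_(i < size X) X`_i.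
have [D D0 [N NE]] := clear_denominators (cokermx M).
exists N => v.
have -> : toR N = D%:~R *: cokermx (map_mx ratr M : 'M[R]_(_, _)).
  rewrite -map_cokermx; apply/matrixP => i j.
  have := congr1 (fun M : 'M[rat]_m => ratr (M i j) : R) NE.
  by rewrite !mxE rmorphM /= !ratr_int.
rewrite -scalemxAr scaler_eq0 intr_eq0 (negPf D0) -submxE /=.
rewrite mem_span_rows; set M1 := \matrix_(i < _) _.
suff /eqmxP -> : (M1 == map_mx ratr M)%MS by [].
have sz : size [seq (map_mx ratr x : 'rV[R]_m) | x <- X] = size X.
  exact: size_map.
have rE (i : 'I_(size X)) : row (cast_ord (esym sz) i) M1 = row i (map_mx ratr M).
  by rewrite -map_row !rowK /= (nth_map 0).
apply/andP; split; apply/row_subP => i; last by rewrite -rE row_sub.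
by rewrite -(cast_ordK sz i) rE row_sub.
Qed.

Lemma kernel_basis (l k q : nat) (V : {vspace 'rV[R]_(l + k)})
    (N : 'M[int]_(l + k, q)) :
  \rank (toR N) = l -> (forall v, (v \in V) = (v *m toR N == 0)) ->
  exists P : 'M[int]_(l + k), [/\ P \in unitmx, dsubmx P *m N = 0 &
    row_space_of (toR (dsubmx P)) V].
Proof.
move=> rN VN; have [P Pu PN] := unimodular_kernel rN; exists P; split => //.
have sub : (toR (dsubmx P) <= kermx (toR N))%MS.
  by apply/sub_kermxP; rewrite -map_mxM PN map_mx0.
have fP : row_free (toR (dsubmx P)).
  by rewrite map_dsubmx row_free_dsubmx // row_free_unit unitmx_intr.
have /eqmxP PK : (toR (dsubmx P) == kermx (toR N))%MS.
  rewrite -(geq_leqif (mxrank_leqif_eq sub)) mxrank_ker rN addKn.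
  by move: fP; rewrite /row_free => /eqP ->.
by move=> v; rewrite VN PK; apply/eqP/sub_kermxP.
Qed.

Lemma dsubmx_right_inverse (l k : nat) (P : 'M[int]_(l + k)) :
  P \in unitmx -> dsubmx P *m rsubmx (invmx P) = 1%:M.
Proof.
move=> Pu; have /(congr1 drsubmx) := mulmxV Pu.
rewrite -{1}[P]vsubmxK -{1}[invmx _]hsubmxK mul_col_row block_mxKdr => ->.
by rewrite scalar_mx_block block_mxKdr.
Qed.

Lemma rational_unimodular (l k : nat) (V : {vspace 'rV[R]_(l + k)}) :
  rational_sub V -> \dim V = k ->
  exists2 P : 'M[int]_(l + k), P \in unitmx & row_space_of (toR (dsubmx P)) V.
Proof.
move=> /rational_kernel[N VN] dV.
have VK : row_space_of (kermx (toR N)) V.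
  by move=> v; rewrite VN; apply/eqP/sub_kermxP.
have := dim_row_space VK; rewrite dV mxrank_ker => kE.
have rN : \rank (toR N) = l by have := rank_leq_row (toR N); lia.
by have [P []] := kernel_basis rN VN; exists P.
Qed.

(** The right inverse [B] expresses that the rows of [A] generate all the integer
points of [V]. *)
Lemma rational_basis (k m : nat) (V : {vspace 'rV[R]_m}) :
  rational_sub V -> \dim V = k ->
  exists (A : 'M[int]_(k, m)) (B : 'M[int]_(m, k)),
    A *m B = 1%:M /\ row_space_of (toR A) V.
Proof.
move=> rV dV; have km : (k <= m)%N.
  by rewrite -dV (leq_trans (dimvS (subvf V))) // dimvf /dim /= mul1n.
have [l lE] : exists l, m = (l + k)%N by exists (m - k)%N; rewrite subnK.
subst m; have [P Pu VP] := rational_unimodular rV dV.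
by exists (dsubmx P), (rsubmx (invmx P)); split => //; exact: dsubmx_right_inverse.
Qed.

Lemma height_ge1 (m : nat) (V : {vspace 'rV[R]_m}) :
  rational_sub V -> 1 <= height V.
Proof.
move=> rV; have [A [B [AB VA]]] := rational_basis rV (erefl _).
rewrite (height_basis AB VA) -(@ler_pXn2r _ 2) ?nnegrE ?sqrtr_ge0 // expr1n.
rewrite sqr_l2norm_wedge map_trmx -map_mxM det_map_mx ler1z.
have : 0 < \det (toR (A *m A^T)).
  rewrite map_mxM -map_trmx lt_def -sqr_l2norm_wedge sqr_ge0 sqr_l2norm_wedge andbT.
  by rewrite -unitfE -unitmxE gram_unitmx // (row_free_right_inverse AB).
by rewrite det_map_mx ltr0z gtz0_ge1.
Qed.

(** The rows of [A] are integral combinations, with a matrix of determinant at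
least [1] in absolute value, of the basis of [rational_basis]. *)
Lemma height_le (k m : nat) (A : 'M[int]_(k, m)) (V : {vspace 'rV[R]_m}) :
  row_free (toR A) -> row_space_of (toR A) V ->
  height V ^+ 2 <= \det (toR A *m (toR A)^T).
Proof.
move=> fA VA.
have [A0 [B0 [AB0 VA0]]] := rational_basis (rational_row_space VA) (dim_row_free fA VA).
have [K KE] : exists K, toR A = K *m toR A0.
  by apply/submxP; rewrite (row_space_eqmx VA VA0).
have {}KE : toR A = toR (A *m B0) *m toR A0.
  by rewrite map_mxM KE -(mulmxA K) -map_mxM AB0 map_mx1 mulmx1.
rewrite (height_basis AB0 VA0) -sqr_l2norm_wedge !sqr_sqrtr ?sumr_ge0 //; last 2 first.
- by move=> f _; exact: sqr_ge0.
- by move=> f _; exact: sqr_ge0.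
apply: ler_sum => f _; rewrite KE wedge_mul exprMn ler_peMl ?sqr_ge0 //.
rewrite det_map_mx -rmorphXn /= ler1z -gtz0_ge1 lt_def sqr_ge0 andbT expf_neq0 //.
rewrite -(intr_eq0 R) -det_map_mx -unitfE -unitmxE -row_free_unit.
apply: inj_row_free => v vK; apply: (row_free_inj fA).
by rewrite KE mulmxA vK !mul0mx.
Qed.

End Height.

(** * Finiteness properties and kernels of integral forms *)

Section Subspaces.

Variable R : realType.

Local Notation toR := (map_mx (intr : int -> R)).

Lemma vspace_neq0 (m k : nat) (V : {vspace 'rV[R]_m}) :
  \dim V = k.+1 -> V != 0%VS.
Proof. by move=> dV; apply/eqP => V0; rewrite V0 dimv0 in dV. Qed.

Lemma dot_int_neq0 (m : nat) (x : 'rV[R]_m) (a : 'rV[int]_m) :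
  lin_indep_over_Q x -> a != 0 -> dot (toR a) x != 0.
Proof.
move=> hx; apply: contraNneq => ax.
have /rowP a0 : map_mx intr a = 0 :> 'rV[rat]_m.
  apply: hx; rewrite -[RHS]ax /dot mxE; apply: eq_bigr => i _.
  by rewrite !mxE ratr_int.
by apply/eqP/rowP => i; have := a0 i; rewrite !mxE => /eqP; rewrite intr_eq0 => /eqP.
Qed.

Lemma lin_indep_neq0 (m : nat) (x : 'rV[R]_m) :
  lin_indep_over_Q x -> (0 < m)%N -> x != 0.
Proof.
move=> hx m0; have a0 : const_mx 1 != 0 :> 'rV[int]_m.
  by apply/rV0Pn; exists (Ordinal m0); rewrite mxE.
apply: contraNneq (dot_int_neq0 hx a0) => ->.
by rewrite /dot trmx0 mulmx0 mxE.
Qed.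

(** A proper rational subspace is contained in the kernel of an integral linear
form, which does not vanish at [x]. *)
Lemma pdist_sub_gt0 (m : nat) (x : 'rV[R]_m) (V : {vspace 'rV[R]_m}) :
  lin_indep_over_Q x -> rational_sub V -> V != 0%VS -> (\dim V < m)%N ->
  0 < pdist_sub x V.
Proof.
move=> hx rV V0 Vm; have [N VN] := rational_kernel rV.
have x0 : x != 0 by apply: lin_indep_neq0 hx _; exact: leq_ltn_trans Vm.
have [j Nj] : exists j, (row j N^T) != 0.
  apply/existsP; apply: contraLR Vm => /existsPn N0; rewrite -leqNgt.
  suff -> : V = fullv by rewrite dimvf /dim /= mul1n.
  apply/vspaceP => v; rewrite memvf VN.
  suff -> : N = 0 by rewrite map_mx0 mulmx0 eqxx.
  apply: trmx_inj; rewrite trmx0; apply/row_matrixP => i; rewrite row0.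
  by apply/eqP; have := N0 i; rewrite negbK.
set a := row j N^T in Nj.
have aV v : v \in V -> dot (toR a) v = 0.
  rewrite VN => /eqP /rowP/(_ j); rewrite !mxE => vN.
  by rewrite dotC -[RHS]vN /dot mxE; apply: eq_bigr => i _; rewrite !mxE.
have ax := dot_int_neq0 hx Nj.
have a0 : 0 < enorm (toR a).
  by rewrite enorm_gt0; apply: contraNneq ax => ->; rewrite /dot mul0mx mxE.
have nx : 0 < enorm x by rewrite enorm_gt0.
pose delta := `|dot (toR a) x| / (enorm (toR a) * enorm x) / 2.
have d0 : 0 < delta by rewrite !divr_gt0 ?normr_gt0 ?mulr_gt0.
rewrite (lt_le_trans d0) // leNgt; apply/negP => /(pdist_sub_approx x0 V0)[y yV].
rewrite leNgt => /negP; apply.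
have : `|dot (toR a) x| <= enorm (toR a) * enorm (x - y).
  by rewrite (le_trans _ (cauchy_schwarz _ _)) // !dotE (aV _ yV) subr0.
rewrite -ler_pdivrMl // => /(lt_le_trans _); apply.
rewrite /delta -subr_gt0.
have -> : (enorm (toR a))^-1 * `|dot (toR a) x| -
    `|dot (toR a) x| / (enorm (toR a) * enorm x) / 2 * enorm x =
    (enorm (toR a))^-1 * `|dot (toR a) x| / 2.
  by field; rewrite !gt_eqF.
by rewrite divr_gt0 // mulr_gt0 ?invr_gt0 ?normr_gt0.
Qed.

Lemma infinite_of_pdist_sub (m : nat) (x : 'rV[R]_m)
    (S : set {vspace 'rV[R]_m}) :
  lin_indep_over_Q x ->
  (forall V, S V -> [/\ rational_sub V, V != 0%VS & (\dim V < m)%N]) ->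
  (forall e : R, 0 < e -> exists2 V, S V & pdist_sub x V < e) ->
  infinite_set S.
Proof.
move=> hx hS hd /finite_seqP[s sS].
have [e e0 es] : exists2 e : R, 0 < e & forall V, V \in s -> e <= pdist_sub x V.
  have : forall V, V \in s -> S V by move=> V Vs; rewrite sS.
  elim: s {sS} => [_|V s IHs hs]; first by exists 1.
  have [|e e0 es] := IHs; first by move=> W Ws; apply: hs; rewrite inE Ws orbT.
  have [rV V0 Vm] := hS V (hs V (mem_head _ _)).
  exists (Num.min e (pdist_sub x V)); first by rewrite lt_min e0 pdist_sub_gt0.
  by move=> W; rewrite inE ge_min => /predU1P[->|/es ->]; rewrite ?lexx ?orbT.
by have [V] := hd e e0; rewrite sS => /es; rewrite leNgt => /negP.
Qed.

(** Northcott's finiteness: a rational subspace is determined by the integral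
Plücker coordinates whose norm is its height, by [wedge_inj]. *)
Lemma northcott (k m : nat) (S : set {vspace 'rV[R]_m}) :
  infinite_set S -> (forall V, S V -> rational_sub V /\ \dim V = k) ->
  forall B : R, exists2 V, S V & B < height V.
Proof.
move=> Sinf hS B; apply: contrapT => nB.
have hB V : S V -> height V <= B.
  by move=> SV; rewrite leNgt; apply/negP => BV; apply: nB; exists V.
apply: Sinf.
(* [dec] enumerates the coordinate vectors with entries between [- N] and [N]. *)
pose N := Num.truncn B.
pose dec (t : {ffun multi_index k m -> 'I_(2 * N).+1}) :=
  [ffun f => (t f : nat)%:Z - N%:Z] : ext_power int k m.
pose good (t : {ffun multi_index k m -> 'I_(2 * N).+1}) (V : {vspace 'rV[R]_m}) :=
  exists2 A : 'M[int]_(k, m), row_free (toR A) /\ row_space_of (toR A) V &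
    wedge A = dec t.
have good_uniq t V V' : good t V -> good t V' -> V = V'.
  move=> [A [fA VA] wA] [A' [fA' VA'] wA'].
  apply: (row_space_inj VA VA'); apply/eqmxP/andP.
  have wE : wedge (toR A) = wedge (toR A').
    by apply/ffunP => f; rewrite !wedge_intr wA wA'.
  by split; apply: wedge_inj.
apply: (@sub_finite_set _ _ ((fun t => xget 0%VS (good t)) @` setT)); last first.
  by apply: finite_image; exact: finite_finset.
move=> V SV; have [rV dV] := hS V SV.
have [A [A' [AA' VA]]] := rational_basis rV dV.
have fA := row_free_right_inverse R AA'.
have wA f : (`|wedge A f| <= N)%N.
  have wB : `|(wedge A f)%:~R| <= B :> R.
    apply: le_trans (hB V SV); rewrite (height_basis AA' VA) -sqrtr_sqr.
    rewrite ler_sqrt; last first.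
      by apply: sumr_ge0 => g _; exact: sqr_ge0.
    rewrite (bigD1 f) //= -wedge_intr.
    by rewrite lerDl; apply: sumr_ge0 => g _; exact: sqr_ge0.
  rewrite /N truncn_ge_nat; last exact: le_trans wB.
  by rewrite natr_absz intr_norm.
pose t : {ffun multi_index k m -> 'I_(2 * N).+1} :=
  [ffun f => inord `|wedge A f + N%:Z|].
exists t => //; apply: xget_unique.
  exists A => //; apply/ffunP => f; rewrite !ffunE inordK.
    have := wA f; rewrite ffunE; lia.
  by have := wA f; rewrite ffunE; lia.
by move=> V' gV'; apply: good_uniq gV' _; exists A => //; apply/ffunP => f;
  rewrite !ffunE inordK; have := wA f; rewrite ffunE; lia.
Qed.

(** By [gram_dual], applied to the unimodular matrix of [unimodular_kernel]. *)
Lemma kernel_height (l k : nat) (N : 'M[int]_(l + k, l)) :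
  0 < \det ((toR N)^T *m toR N) ->
  exists V : {vspace 'rV[R]_(l + k)}, [/\ rational_sub V, \dim V = k,
    (forall v, (v \in V) = (v *m toR N == 0)) &
    height V ^+ 2 <= \det ((toR N)^T *m toR N)].
Proof.
move=> dN; have rN : \rank (toR N) = l.
  rewrite -mxrank_tr; apply/eqP; apply/row_freeP.
  exists (toR N *m invmx ((toR N)^T *m toR N)).
  by rewrite mulmxA mulmxV // unitmxE unitfE gt_eqF.
pose V := span [seq row i (kermx (toR N)) | i <- enum 'I_(l + k)].
have VN v : (v \in V) = (v *m toR N == 0).
  by rewrite row_space_exists; apply/sub_kermxP/eqP.
have [P [Pu PN VP]] := kernel_basis rN VN.
have PRu := unitmx_intr R Pu.
have fP : row_free (toR (dsubmx P)) by rewrite map_dsubmx row_free_dsubmx // row_free_unit.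
exists V; split => //; first exact: rational_row_space VP.
  exact: dim_row_free fP VP.
have PX : toR P *m toR N = col_mx (toR (usubmx (P *m N))) 0.
  by rewrite -map_mxM -{1}[P *m N]vsubmxK -mul_dsub_mx PN map_col_mx map_mx0.
have := gram_dual PRu PX.
rewrite -map_dsubmx det_map_mx -rmorphXn /= [\det (toR P)]det_map_mx -rmorphXn /=.
have -> : \det P ^+ 2 = 1.
  exact: sqr_det_unitmx.
rewrite mulr1 => GE; apply: le_trans (height_le fP VP) _; rewrite -GE.
apply: ler_peMr; first by rewrite -sqr_l2norm_wedge sqr_ge0.
rewrite ler1z -gtz0_ge1 lt_def sqr_ge0 andbT expf_neq0 //.
by apply: contraTneq dN => K0; rewrite -GE K0 expr0n mulr0 ltxx.
Qed.

(** The equation of a hyperplane is a column of a unimodular matrix, and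
[gram_dual] gives its norm.  The witness [e] of primitivity is what keeps other
integral forms from being fractional multiples of [a]. *)
Lemma hyperplane_normal (n : nat) (V : {vspace 'rV[R]_(1 + n)}) :
  rational_sub V -> \dim V = n ->
  exists a e : 'rV[int]_(1 + n), [/\ a *m e^T = 1%:M,
    enorm (toR a) = height V & forall v, v \in V -> dot (toR a) v = 0].
Proof.
move=> rV dV; have [P Pu VP] := rational_unimodular rV dV.
pose X := lsubmx (invmx P).
have PX : P *m X = col_mx 1%:M 0.
  have /(congr1 lsubmx) := mulmxV Pu.
  rewrite -{1}[invmx P]hsubmxK mul_mx_row row_mxKl -/X => ->.
  by rewrite scalar_mx_block block_mxEh row_mxKl.
have PRX : toR P *m toR X = col_mx (toR 1%:M) 0.
  by rewrite -map_mxM PX map_col_mx map_mx0.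
have aV : enorm (toR X^T) = height V.
  rewrite (height_basis (dsubmx_right_inverse Pu) VP).
  apply/eqP; rewrite -(@eqrXn2 _ 2) ?enorm_ge0 ?sqrtr_ge0 //.
  rewrite sqr_l2norm_wedge map_dsubmx sqr_enorm.
  have := gram_dual (unitmx_intr R Pu) PRX.
  rewrite map_mx1 det1 expr1n mulr1 [\det (toR P)]det_map_mx -rmorphXn /=.
  rewrite sqr_det_unitmx // mulr1 det_mx11 => ->.
  by rewrite /dot !map_trmx trmxK.
exists X^T, (usubmx P); split=> // [|v].
  by rewrite -trmx_mul mul_usub_mx PX col_mxKu trmx1.
rewrite VP => /submxP[u ->]; rewrite /dot -map_trmx -trmx_mul -mulmxA.
by rewrite map_dsubmx mul_dsub_mx PRX col_mxKd mulmx0 trmx0 mxE.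
Qed.

End Subspaces.

(** * Hyperplanes of a rational subspace *)

Section Descent.

Variable R : realType.

Local Notation toR := (map_mx (intr : int -> R)).

Lemma enorm_le_coord (m : nat) (x : 'rV[R]_m) (t : R) :
  0 <= t -> (forall j, `|x 0 j| <= t) -> enorm x <= m%:R * t.
Proof.
move=> t0 xt; rewrite -(@ler_pXn2r _ 2) ?nnegrE ?enorm_ge0 ?mulr_ge0 //.
rewrite sqr_enorm /dot dotvvE (@le_trans _ _ (m%:R * t ^+ 2)) //.
  rewrite mulr_natl -[in leRHS](card_ord m) -sumr_const; apply: ler_sum => i _.
  by rewrite -real_normK ?num_real // lerXn2r ?nnegrE.
rewrite exprMn ler_wpM2r ?sqr_ge0 // -natrX ler_nat.
by case: m {x xt} => // m; rewrite expnS leq_pmulr.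
Qed.

Lemma enorm_isometry (k m : nat) (F : 'M[R]_(k, m)) (u : 'rV[R]_k) :
  F *m F^T = 1%:M -> enorm (u *m F) = enorm u.
Proof.
by move=> FF; rewrite !enormE /dot trmx_mul mulmxA -(mulmxA u) FF mulmx1.
Qed.

Lemma adapted_orthonormal_basis (d m : nat) (A : 'M[R]_(1 + d, m))
    (y : 'rV[R]_m) :
  row_free A -> (y <= A)%MS -> exists S F, [/\ A = S *m F, F *m F^T = 1%:M,
    S \in unitmx & y = row_mx (enorm y)%:M 0 *m F].
Proof.
move=> fA /submxP[t yE].
have [S [F [AE FF Su]]] := gram_schmidt fA.
have [Q [QQ sQ]] := rotate_to_axis (t *m S).
have QQ' : Q^T *m Q = 1%:M by exact: mulmx1C.
exists (S *m Q), (Q^T *m F).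
have FF' : Q^T *m F *m (Q^T *m F)^T = 1%:M.
  by rewrite trmx_mul trmxK mulmxA -(mulmxA _ F) FF mulmx1.
have yF : y = row_mx (Num.sqrt ((t *m S *m (t *m S)^T) 0 0))%:M 0 *m (Q^T *m F).
  by rewrite -sQ yE AE !mulmxA -(mulmxA (t *m S)) QQ mulmx1.
split => //.
- by rewrite mulmxA -(mulmxA S) QQ mulmx1.
- by rewrite unitmx_mul Su; case/mulmx1_unit: QQ.
rewrite {1}yF; congr (row_mx _%:M _ *m _).
by rewrite yE AE mulmxA enorm_isometry // enormE.
Qed.

(** Inside a rational [V] of dimension [d + 1], the hyperplanes are the kernels
of the integral linear forms [c] on the lattice of integer points of [V].  In
an orthonormal basis of [V] starting at the direction of [y], such a form has
a coordinate vector [gm]; the height of its kernel is at most [height V] times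
the norm of [gm], and the distance from [y] is measured by the first coordinate
of [gm].  [minkowski_linear_forms] makes both small. *)
Lemma rational_hyperplane (d m : nat) :
  exists2 C : R, 1 <= C & forall (V : {vspace 'rV[R]_m}) (y : 'rV[R]_m) (b : R),
    rational_sub V -> \dim V = (1 + d)%N -> y \in V -> 1 <= b ->
    exists (W : {vspace 'rV[R]_m}) (z : 'rV[R]_m) (D : R),
    [/\ rational_sub W, \dim W = d & z \in W] /\
    [/\ height W <= D, 0 < D, D <= C * height V * b &
        enorm (y - z) * D <= C * enorm y / b ^+ d].
Proof.
have [C0 C01 mink] := minkowski_linear_forms R (1 + d).
exists ((1 + d)%:R * C0).
  by rewrite -[leLHS]mul1r ler_pM // ler1n.
move=> V y b rV dV yV b1.
have [A [B [AB VA]]] := rational_basis rV dV.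
have H1 := height_ge1 rV; set H := height V in H1 *.
have fA := row_free_right_inverse R AB.
have [|S [F [AE FF Su yE]]] := @adapted_orthonormal_basis d m (toR A) y fA.
  by rewrite -VA.
set sg := enorm y in yE *.
have sg0 : 0 <= sg by exact: enorm_ge0.
have b0 : 0 < b by exact: lt_le_trans b1.
have H0 : 0 < H by exact: lt_le_trans H1.
have C00 : 0 < C0 by exact: lt_le_trans C01.
have detS : \det S ^+ 2 = H ^+ 2.
  rewrite /H (height_basis AB VA) sqr_l2norm_wedge AE trmx_mul.
  by rewrite mulmxA -(mulmxA S) FF mulmx1 det_mulmx det_tr expr2.
have [a aE] : exists a, a = (H * b ^+ d)^-1 by exists (H * b ^+ d)^-1.
have a0 : 0 < a by rewrite aE invr_gt0 mulr_gt0 ?exprn_gt0.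
have ab : a <= b.
  apply: (@le_trans _ _ 1) => //; rewrite aE invf_le1 ?mulr_gt0 ?exprn_gt0 //.
  by rewrite -[leLHS]mul1r ler_pM ?exprn_ege1.
(* The forms are rescaled so that [minkowski_linear_forms] gives the bound [a] on
   the first coordinate and [b] on the others; the choice of [a] makes the
   determinant equal to [1]. *)
pose Dg : 'M[R]_(1 + d) := block_mx (a^-1)%:M 0 0 (b^-1)%:M.
have dB : `|\det ((invmx S)^T *m Dg)| = 1.
  rewrite det_mulmx det_tr det_inv det_ublock !det_scalar expr1 normrM normfV.
  have -> : `|\det S| = H.
    apply/eqP; rewrite -(@eqrXn2 _ 2) ?normr_ge0 ?(ltW H0) // real_normK ?num_real //.
    by rewrite detS.
  have p0 : 0 < a^-1 * b^-1 ^+ d.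
    by rewrite mulr_gt0 ?exprn_gt0 ?invr_gt0.
  rewrite (gtr0_norm p0) aE invrK exprVn.
  by field; rewrite expf_neq0 ?gt_eqF.
have [||c c0 cS] := mink ((invmx S)^T *m Dg) isT.
- by rewrite unitmxE unitfE -normr_gt0 dB.
- by rewrite dB.
pose gm := toR c *m (invmx S)^T.
have gmD : toR c *m ((invmx S)^T *m Dg) =
    row_mx (a^-1 *: lsubmx gm) (b^-1 *: rsubmx gm).
  rewrite mulmxA -/gm -{1}[gm]hsubmxK /Dg mul_row_block !mulmx0 addr0 add0r.
  by rewrite !mul_mx_scalar.
have gm_l : `|gm 0 (lshift d 0)| <= C0 * a.
  have := cS (lshift d 0); rewrite gmD row_mxEl mxE [lsubmx gm _ _]mxE.
  by rewrite normrM normfV (gtr0_norm a0) ler_pdivrMl // mulrC.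
have gm_r (j : 'I_d) : `|gm 0 (rshift 1 j)| <= C0 * b.
  have := cS (rshift 1 j); rewrite gmD row_mxEr mxE [rsubmx gm _ _]mxE.
  by rewrite normrM normfV (gtr0_norm b0) ler_pdivrMl // mulrC.
have gm_n : enorm gm <= (1 + d)%:R * (C0 * b).
  apply: enorm_le_coord => [|j]; first by rewrite mulr_ge0 // ltW.
  case: (splitP j) => i ij.
    have -> : j = lshift d 0 by apply: val_inj; rewrite /= ij (ord1 i).
    by rewrite (le_trans gm_l) // ler_pM2l.
  by have -> : j = rshift 1 i by exact: val_inj.
have gm0 : gm != 0.
  apply: contraNneq c0 => gm0; apply/eqP.
  have /rowP cR0 : toR c = 0.
    apply: (row_free_inj (_ : row_free (invmx S)^T)).
      by rewrite row_free_unit unitmx_tr unitmx_inv.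
    by rewrite mul0mx.
  by apply/rowP => i; have := cR0 i; rewrite !mxE => /eqP; rewrite intr_eq0 => /eqP.
have ngm : 0 < enorm gm by rewrite enorm_gt0.
(* The last rows of [P] generate the integral kernel of [c], in coordinates on
   the basis [A]; hence [W] is the kernel of [c] in [V]. *)
have rc : \rank (toR c^T) = 1%N.
  rewrite -map_trmx mxrank_tr rank_rV.
  suff -> : toR c != 0 by [].
  by apply: contraNneq gm0 => cR0; rewrite /gm cR0 mul0mx.
have [P Pu Pc] := unimodular_kernel rc.
have PRu := unitmx_intr R Pu.
pose M := dsubmx P *m A.
have ME : toR M = dsubmx (toR P *m S) *m F.
  by rewrite map_mxM map_dsubmx AE mulmxA -[in RHS]mul_dsub_mx.
have fM : row_free (toR M).
  rewrite /row_free map_mxM mxrankMfree // -/(row_free _) map_dsubmx.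
  by rewrite row_free_dsubmx // row_free_unit.
have [W WM] : exists W, row_space_of (toR M) W.
  by eexists; exact: row_space_exists.
have PSg : toR P *m S *m gm^T = col_mx (toR (usubmx (P *m c^T))) 0.
  rewrite /gm trmx_mul trmxK -mulmxA mulKVmx // map_trmx -map_mxM.
  by rewrite -{1}[P *m c^T]vsubmxK -mul_dsub_mx Pc map_col_mx map_mx0.
set K := usubmx (P *m c^T) in PSg.
have PSu : toR P *m S \in unitmx by rewrite unitmx_mul PRu.
have K0 : \det K != 0.
  apply: contraNneq gm0 => K0.
  have KR0 : toR K = 0.
    by rewrite [K]mx11_scalar -det_mx11 K0 map_scalar_mx raddf0.
  rewrite -trmx_eq0 -(mulKmx PSu gm^T) PSg KR0 col_mx0 mulmx0 //.
have hW : height W <= H * enorm gm.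
  rewrite -(@ler_pXn2r _ 2) ?nnegrE ?mulr_ge0 ?enorm_ge0 ?(ltW H0) //; last first.
    by rewrite (le_trans ler01) // height_ge1 //; exact: rational_row_space WM.
  apply: le_trans (height_le fM WM) _.
  have := gram_dual PSu PSg.
  rewrite trmxK [\det (gm *m _)]det_mx11 -/(dot gm gm) -sqr_enorm.
  rewrite [\det (toR K)]det_map_mx -rmorphXn /=.
  rewrite det_mulmx exprMn detS [\det (toR P)]det_map_mx -rmorphXn /=.
  rewrite (sqr_det_unitmx Pu) mul1r.
  rewrite -exprMn mulrC [enorm gm * _]mulrC => <-.
  have -> : toR M *m (toR M)^T =
      dsubmx (toR P *m S) *m (dsubmx (toR P *m S))^T.
    by rewrite ME trmx_mul mulmxA -(mulmxA _ F) FF mulmx1.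
  apply: ler_peMl; first by rewrite -sqr_l2norm_wedge sqr_ge0.
  by rewrite ler1z -gtz0_ge1 lt_def sqr_ge0 andbT expf_neq0.
(* [u] is [y] in orthonormal coordinates, and [z] is its orthogonal projection. *)
pose u : 'rV[R]_(1 + d) := row_mx sg%:M 0.
pose r := sg * gm 0 (lshift d 0) / dot gm gm.
have gg : dot gm gm != 0 by rewrite dotvv_eq0.
have ugm : dot u gm = sg * gm 0 (lshift d 0).
  rewrite /dot /u -[gm]hsubmxK tr_row_mx mul_row_col mul0mx addr0 mul_scalar_mx.
  by rewrite mxE [_^T _ _]mxE row_mxEl.
pose z := (u - r *: gm) *m F.
exists W, z, (H * enorm gm); split; split.
- exact: rational_row_space WM.
- exact: dim_row_free fM WM.
- rewrite WM.
  have uE : (u - r *: gm) *m gm^T = 0.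
    rewrite [LHS]mx11_scalar -/(dot _ _) !dotE ugm /r divfK // subrr.
    exact: raddf0.
  pose t : 'rV[R]_(1 + d) := (u - r *: gm) *m invmx (toR P *m S).
  have tu : u - r *: gm = t *m (toR P *m S) by rewrite /t mulmxKV.
  have : lsubmx t *m toR K = 0.
    rewrite -[RHS]uE tu -mulmxA PSg -{2}[t]hsubmxK mul_row_col mulmx0 addr0 //.
  move=> tK; have tl : lsubmx t = 0.
    apply: (row_free_inj (_ : row_free (toR K))); last by rewrite mul0mx.
    by rewrite row_free_unit unitmxE unitfE det_map_mx intr_eq0.
  apply/submxP; exists (rsubmx t).
  rewrite /z tu ME [RHS]mulmxA; congr (_ *m _).
  by rewrite -{1}[t]hsubmxK -[toR P *m S]vsubmxK mul_row_col tl mul0mx add0r col_mxKd.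
- exact: hW.
- by rewrite mulr_gt0.
- rewrite mulrC (le_trans (ler_wpM2r (ltW H0) gm_n)) //.
  by rewrite le_eqVlt; apply/orP; left; apply/eqP; ring.
have -> : y - z = r *: gm *m F.
  by rewrite yE -/u /z -mulmxBl opprB addrC subrK.
rewrite enorm_isometry // enormZ /r normrM normfV normrM.
rewrite (ger0_norm sg0) -sqr_enorm (ger0_norm (sqr_ge0 _)).
have -> : sg * `|gm 0 (lshift d 0)| / enorm gm ^+ 2 * enorm gm * (H * enorm gm) =
    sg * H * `|gm 0 (lshift d 0)|.
  by field; rewrite gt_eqF.
apply: le_trans (ler_wpM2l _ gm_l) _; first by rewrite mulr_ge0 // ltW.
have -> : sg * H * (C0 * a) = 1 * (C0 * sg / b ^+ d).
  by rewrite aE; field; rewrite expf_neq0 ?gt_eqF.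
rewrite -!mulrA ler_wpM2r ?ler1n //.
by rewrite mulr_ge0 ?(ltW C00) // mulr_ge0 // invr_ge0 exprn_ge0 // ltW.
Qed.

End Descent.

(** * Going down by one dimension *)

Section Approximants.

Variable R : realType.

Local Notation toR := (map_mx (intr : int -> R)).

Definition approximants (m : nat) (x : 'rV[R]_m) (k : nat) (w : R) :
    set {vspace 'rV[R]_m} :=
  [set V | [/\ rational_sub V, \dim V = k &
    pdist_sub x V <= height V `^ (- 1 - w)]]%classic.

Definition uniform_exponent_set (m : nat) (x : 'rV[R]_m) : set R :=
  [set w : R | \forall X \near +oo, exists a : 'rV[int]_m,
    [/\ a != 0, forall i, `|a 0 i|%:~R <= X &
      `|dot (toR a) x| <= X `^ (- w)]]%classic.

Lemma powR_large (eta K : R) : 0 < eta ->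
  exists2 B : R, 1 <= B & forall T, B < T -> K < T `^ eta.
Proof.
move=> eta0; pose M := Num.max K 1.
have M1 : 1 <= M by rewrite le_max lexx orbT.
have M0 : 0 <= M by exact: le_trans M1.
exists (M `^ eta^-1).
  by rewrite -[leLHS](powRr0 M) ler_powR // invr_ge0 ltW.
move=> T BT; apply: (@le_lt_trans _ _ M); first by rewrite le_max lexx.
rewrite -[M](powRr1 M0) -(mulVf (lt0r_neq0 eta0)) powRrM.
by apply: gt0_ltr_powR => //; rewrite nnegrE ?powR_ge0 // (le_trans _ (ltW BT)) ?powR_ge0.
Qed.

(** The bookkeeping common to all the constructions below: [T] is a large
parameter, [z] in [W] is close to [x], and both the height of [W] and the
distance are controlled by powers of [T] through a bound [D] of the height. *)
Lemma approximants_criterion (m k : nat) (x z : 'rV[R]_m)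
    (W : {vspace 'rV[R]_m}) (T D K1 K2 al be w e : R) :
  x != 0 -> rational_sub W -> \dim W = k -> z \in W ->
  1 <= T -> 0 <= K1 -> 1 <= K2 -> 0 <= be -> 0 <= w -> 0 < e ->
  height W <= D -> D <= K2 * T `^ be ->
  enorm (x - z) / enorm x * D <= K1 * T `^ (- al) ->
  K1 * K2 `^ w * Num.max 1 e^-1 < T `^ (al - w * be) ->
  approximants x k w W /\ pdist_sub x W < e.
Proof.
move=> x0 rW dW zW T1 K10 K21 be0 w0 e0 hD DK distD small.
have T0 : 0 < T by exact: lt_le_trans T1.
have K20 : 0 < K2 by exact: lt_le_trans K21.
have h1 := height_ge1 rW.
have D1 : 1 <= D by exact: le_trans hD.
have D0 : 0 < D by exact: lt_le_trans D1.
have h0 : 0 < height W by exact: lt_le_trans h1.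
have nx : 0 < enorm x by rewrite enorm_gt0.
set dist := enorm (x - z) / enorm x in distD *.
have DW : D `^ w <= K2 `^ w * T `^ (w * be).
  rewrite mulrC [w * be]mulrC powRrM -powRM ?powR_ge0 ?(ltW K20) // mulrC.
  by apply: ge0_ler_powR => //; rewrite nnegrE ?(ltW D0) ?mulr_ge0 ?powR_ge0 ?(ltW K20).
set Mx := Num.max 1 e^-1 in small.
have key : dist * D * D `^ w * Mx < 1.
  have : dist * D * D `^ w * Mx <= K1 * T `^ (- al) * (K2 `^ w * T `^ (w * be)) * Mx.
    rewrite ler_wpM2r ?le_max ?ler01 //.
    apply: ler_pM => //; last exact: powR_ge0.
    by rewrite mulr_ge0 ?(ltW D0) // divr_ge0 ?enorm_ge0.
  move=> /le_lt_trans; apply.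
  rewrite powRN.
  have -> : K1 * (T `^ al)^-1 * (K2 `^ w * T `^ (w * be)) * Mx =
     (K1 * K2 `^ w * Mx) / (T `^ al / T `^ (w * be)).
    by field; rewrite !gt_eqF ?powR_gt0.
  rewrite -powRB; last by rewrite (gt_eqF T0) implybT.
  by rewrite ltr_pdivrMr ?powR_gt0 // mul1r.
have dist0 : 0 <= dist by rewrite divr_ge0 ?enorm_ge0.
have Dw1 : 1 <= D `^ w by rewrite -[leLHS](powRr0 D) ler_powR.
have Mx1 : 1 <= Mx by rewrite le_max lexx.
have distlt : dist * D `^ (1 + w) < Mx^-1.
  rewrite powRD ?(gt_eqF D0) ?implybT // powRr1 ?(ltW D0) //.
  by rewrite -[ltRHS]mul1r ltr_pdivlMr ?(lt_le_trans ltr01 Mx1) // mulrA.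
have Mxi : Mx^-1 <= 1 by rewrite invf_le1 // (lt_le_trans ltr01 Mx1).
have Mxe : Mx^-1 <= e.
  rewrite -[e]invrK lef_pV2 ?posrE ?invr_gt0 ?(lt_le_trans ltr01 Mx1) //.
  by rewrite le_max lexx orbT.
have Dw2 : 1 <= D `^ (1 + w) by rewrite -[leLHS](powRr0 D) ler_powR // addr_ge0.
have dist_lt : dist < Mx^-1.
  by apply: le_lt_trans distlt; rewrite ler_peMr.
have z0 : z != 0.
  apply: contraTneq (lt_le_trans dist_lt Mxi) => z0.
  by rewrite /dist z0 subr0 divff ?gt_eqF // ltxx.
have pW := pdist_sub_le x0 zW z0.
split; last by apply: le_lt_trans pW _; exact: lt_le_trans dist_lt Mxe.
split => //; apply: le_trans pW _; rewrite -/dist.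
have -> : - 1 - w = - (1 + w) by ring.
rewrite powRN -[leRHS]mul1r ler_pdivlMr ?powR_gt0 //.
apply: (@le_trans _ _ (dist * D `^ (1 + w))); last exact: le_trans (ltW distlt) Mxi.
rewrite ler_wpM2l //; apply: ge0_ler_powR => //.
- by rewrite addr_ge0.
- by rewrite nnegrE ltW.
- by rewrite nnegrE ltW.
Qed.

Lemma approximants_infinite (m k : nat) (x : 'rV[R]_m) (w : R) :
  lin_indep_over_Q x -> (0 < k < m)%N ->
  (forall e : R, 0 < e -> exists2 V, approximants x k w V & pdist_sub x V < e) ->
  infinite_set (approximants x k w).
Proof.
move=> hx /andP[k0 km]; apply: infinite_of_pdist_sub => // V [rV dV _].
split=> //; rewrite ?dV //; apply: (@vspace_neq0 _ _ k.-1).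
by rewrite dV prednK.
Qed.

(** Going down: a subspace [V] of dimension [d + 1] close to [x] and of large
height [H] contains a point [y] close to [x], and [rational_hyperplane] with
[b = H^(w / (d + 1))], the value balancing the two error terms, yields a
hyperplane of [V] close to [y]. *)
Lemma going_down (m d : nat) (x : 'rV[R]_m) (w w' : R) :
  lin_indep_over_Q x -> (0 < d < m)%N -> 0 < w -> 0 <= w' ->
  w' * (w + d%:R + 1) < d%:R * w ->
  infinite_set (approximants x d.+1 w) -> infinite_set (approximants x d w').
Proof.
move=> hx dm w0 w'0 ww' Vinf; apply: approximants_infinite => // e e0.
have m0 : (0 < m)%N by case/andP: dm => _; exact: leq_trans.
have x0 := lin_indep_neq0 hx m0.
have nx : 0 < enorm x by rewrite enorm_gt0.
have [C C1 hyp] := rational_hyperplane R d m.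
have C0 : 0 < C by exact: lt_le_trans C1.
have d1 : 0 < d%:R + 1 :> R by rewrite ltr_wpDl.
pose al := d%:R * w / (d%:R + 1); pose be := (w + d%:R + 1) / (d%:R + 1).
have eta0 : 0 < al - w' * be.
  by rewrite subr_gt0 /al /be mulrA ltr_pM2r ?invr_gt0.
pose K := 5 * C * C `^ w' * Num.max 1 e^-1.
have [B B1 large] := powR_large K eta0.
have [V [rV dV pV] BH] := northcott Vinf (fun V hV =>
  let: And3 rV dV _ := hV in conj rV dV) B.
set H := height V in pV BH.
have H1 : 1 <= H by exact: le_trans (ltW BH).
have H0 : 0 < H by exact: lt_le_trans H1.
have [|y yV xy] := @pdist_sub_approx _ _ x V x0 (2 * H `^ (- 1 - w)) (vspace_neq0 dV).
  by rewrite (le_lt_trans pV) // ltr_pMl ?powR_gt0 // ltr1n.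
have p1 : H `^ (- 1 - w) <= 1.
  rewrite -[leRHS](powRr0 H) ler_powR //; have := w0; lra.
have yx : enorm y <= 3 * enorm x.
  have -> : y = x - (x - y) by rewrite subKr.
  rewrite (le_trans (enormD _ _)) // enormN.
  have : 2 * H `^ (- 1 - w) * enorm x <= 2 * enorm x by rewrite ler_pM2r // ler_piMr.
  by move: xy; lra.
pose b := H `^ (w / (d%:R + 1)).
have b1 : 1 <= b by rewrite -[leLHS](powRr0 H) ler_powR // divr_ge0 // ltW.
have [W [z [D [[rW dW zW] [hD D0 DC yzD]]]]] := hyp V y b rV dV yV b1.
have Hb : H * b = H `^ be.
  rewrite /b -{1}[H]powRr1 ?(ltW H0) // -powRD ?(gt_eqF H0) ?implybT //.
  by congr (_ `^ _); rewrite /be; field; rewrite gt_eqF.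
have bd : (b ^+ d)^-1 = H `^ (- al).
  rewrite powRN /al /b -powR_mulrn ?powR_ge0 // -powRrM; congr (_ `^ _)^-1.
  by rewrite mulrC mulrA.
have HHb : H `^ (- 1 - w) * (H * b) = H `^ (- al).
  rewrite Hb -powRD ?(gt_eqF H0) ?implybT //; congr (_ `^ _).
  by rewrite /al /be; field; rewrite gt_eqF.
suff [WA We] : approximants x d w' W /\ pdist_sub x W < e by exists W.
apply: (approximants_criterion (T := H) (D := D) (K1 := 5 * C)
  (K2 := C) (al := al) (be := be) (z := z)) => //.
- by rewrite mulr_ge0 // ltW.
- by rewrite divr_ge0 ?(ltW d1) // -addrA addr_ge0 ?(ltW w0) ?(ltW d1).
- by rewrite -Hb mulrA.
- rewrite mulrAC ler_pdivrMr //.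
  have xz : enorm (x - z) <= enorm (x - y) + enorm (y - z).
    by rewrite -[x - z](subrKA y) enormD.
  apply: le_trans (ler_wpM2r (ltW D0) xz) _; rewrite mulrDl.
  have t1 : enorm (x - y) * D <= 2 * C * enorm x * H `^ (- al).
    rewrite -HHb; apply: le_trans (ler_pM _ (ltW D0) xy DC) _; first exact: enorm_ge0.
    by rewrite le_eqVlt; apply/orP; left; apply/eqP; rewrite -/H; ring.
  have t2 : enorm (y - z) * D <= 3 * C * enorm x * H `^ (- al).
    apply: le_trans yzD _; rewrite bd ler_wpM2r ?powR_ge0 //.
    by rewrite -mulrA [3 * _]mulrC -mulrA ler_pM2l // mulrC.
  by move: (H `^ (- al)) t1 t2 => p; lra.
by apply: (large H).
Qed.

(** The hyperplane orthogonal to [a] has height at most [enorm (toR a)] and lies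
at Euclidean distance [`|dot (toR a) x| / enorm (toR a)] from [x]. *)
Lemma uniform_le_ordinary (n : nat) (x : 'rV[R]_(1 + n)) (w w' : R) :
  lin_indep_over_Q x -> (0 < n)%N -> 0 <= w' -> w' < w ->
  uniform_exponent_set x w -> infinite_set (approximants x n w').
Proof.
move=> hx n0 w'0 ww' [M [_ hM]]; apply: approximants_infinite => // [|e e0].
  by rewrite n0 leqnn.
have x0 := lin_indep_neq0 hx (ltn0Sn n).
have nx : 0 < enorm x by rewrite enorm_gt0.
have eta0 : 0 < w - w' * 1 by rewrite mulr1 subr_gt0.
pose K := (enorm x)^-1 * (1 + n)%:R `^ w' * Num.max 1 e^-1.
have [B B1 large] := powR_large K eta0.
pose X := Num.max B M + 1.
have BX : B < X by rewrite ltr_pwDr // le_max lexx.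
have MX : M < X by rewrite ltr_pwDr // le_max lexx orbT.
have X1 : 1 <= X by exact: le_trans (ltW BX).
have X0 : 0 < X by exact: lt_le_trans X1.
have [a [a0 aX ax]] := hM X MX.
have aR0 : toR a != 0.
  by apply: contraNneq (dot_int_neq0 hx a0) => ->; rewrite /dot mul0mx mxE.
have na : 0 < enorm (toR a) by rewrite enorm_gt0.
have detE : \det ((toR a^T)^T *m toR a^T) = dot (toR a) (toR a).
  by rewrite det_mx11 -map_trmx trmxK.
have [|V [rV dV VN hV]] := @kernel_height R 1 n a^T.
  by rewrite detE dotvv_gt0.
pose r := dot (toR a) x / dot (toR a) (toR a).
have aa : dot (toR a) (toR a) != 0 by rewrite dotvv_eq0.
suff [VA Ve] : approximants x n w' V /\ pdist_sub x V < e by exists V.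
apply: (approximants_criterion (T := X) (D := enorm (toR a))
  (K1 := (enorm x)^-1) (K2 := (1 + n)%:R) (al := w) (be := 1)
  (z := x - r *: toR a)) => //.
- rewrite VN -map_trmx; apply/eqP; rewrite [LHS]mx11_scalar -/(dot _ _).
  by rewrite !dotE /r divfK // (dotC x) subrr raddf0.
- by rewrite invr_ge0 ltW.
- by rewrite ler1n.
- rewrite -(@ler_pXn2r _ 2) ?nnegrE ?enorm_ge0 //; last first.
    by rewrite (le_trans ler01) // height_ge1.
  by rewrite sqr_enorm -detE.
- rewrite powRr1 ?(ltW X0) //; apply: enorm_le_coord; first exact: ltW.
  by move=> j; rewrite mxE -intr_norm.
- rewrite subKr enormZ /r normrM normfV -sqr_enorm (ger0_norm (sqr_ge0 _)).
  rewrite [leLHS](_ : _ = (enorm x)^-1 * `|dot (toR a) x|).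
    by rewrite ler_pM2l ?invr_gt0.
  by field; rewrite !gt_eqF.
by apply: (large X).
Qed.

End Approximants.

(** * Using the uniform exponent *)

Section Uniform.

Variable R : realType.

Local Notation toR := (map_mx (intr : int -> R)).

(** An integral vector [c] proportional to the primitive vector [a] is an
integral multiple of [a], so it cannot take a smaller non-zero value at [x]. *)
Lemma gram2_gt0 (m : nat) (x : 'rV[R]_m) (a c e : 'rV[int]_m) :
  a *m e^T = 1%:M -> c != 0 -> `|dot (toR c) x| < `|dot (toR a) x| ->
  0 < dot (toR a) (toR a) * dot (toR c) (toR c) - dot (toR a) (toR c) ^+ 2.
Proof.
move=> ae c0 cax; rewrite lt_def -det_gram2 -sqr_l2norm_wedge sqr_ge0 andbT.
rewrite sqr_l2norm_wedge det_gram2; apply/negP => /eqP D0.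
have aa : dot (toR a) (toR a) != 0.
  rewrite dotvv_eq0; apply: contraTneq cax => ->.
  by rewrite [X in _ < `|X|]/dot mul0mx mxE normr0 ltNge normr_ge0.
have cE : dot (toR a) (toR a) *: toR c = dot (toR a) (toR c) *: toR a.
  apply/eqP; rewrite -subr_eq0 -dotvv_eq0 -/(dot _ _) !dotE (dotC (toR c)).
  by move/eqP: D0; rewrite subr_eq0 => /eqP D0; apply/eqP; ring: D0.
have aeR : dot (toR a) (toR e) = 1.
  by rewrite /dot map_trmx -map_mxM ae map_mx1 mxE eqxx.
pose j := (c *m e^T) 0 0.
have jE : dot (toR c) (toR e) = j%:~R.
  by rewrite /dot map_trmx -map_mxM mxE.
have {}cE : toR c = j%:~R *: toR a.
  apply: (scalerI aa); rewrite cE scalerA; congr (_ *: _).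
  have := congr1 (fun v => dot v (toR e)) cE.
  by rewrite !dotZl aeR jE mulr1 => ->.
have j0 : j != 0.
  apply: contraNneq c0 => j0; rewrite j0 scale0r in cE; apply/eqP/rowP => i.
  by have /rowP/(_ i) := cE; rewrite !mxE => /eqP; rewrite intr_eq0 => /eqP.
move: cax; rewrite cE dotZl normrM ltNge => /negP; apply.
by rewrite ler_peMl // -intr_norm ler1z -gtz0_ge1 normr_gt0.
Qed.

(** [W] is the common kernel of [a] and [c], [z] is the orthogonal projection of
[x] to it, and [D] is the area of the parallelogram on [a] and [c]; the length
of [x - z] is that of [p *: c - q *: a] divided by [D], where [p] and [q] are
the values of [a] and [c] at [x]. *)
Lemma intersection_of_hyperplanes (k : nat) (x : 'rV[R]_(1 + k.+1))
    (a c : 'rV[int]_(1 + k.+1)) :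
  0 < dot (toR a) (toR a) * dot (toR c) (toR c) - dot (toR a) (toR c) ^+ 2 ->
  exists (W : {vspace 'rV[R]_(1 + k.+1)}) (z : 'rV[R]_(1 + k.+1)) (D : R),
    [/\ rational_sub W, \dim W = k & z \in W] /\
    [/\ height W <= D, D <= enorm (toR a) * enorm (toR c) &
      enorm (x - z) * D <= `|dot (toR a) x| * enorm (toR c) +
                           `|dot (toR c) x| * enorm (toR a)].
Proof.
set A := toR a; set C := toR c; set Dl := _ - _ => Dl0.
pose N : 'M[int]_(1 + 1 + k, 1 + 1) := (col_mx a c)^T.
have NT : (toR N)^T = col_mx A C.
  by rewrite map_trmx trmxK map_col_mx.
have detN : \det ((toR N)^T *m toR N) = Dl.
  by rewrite -[toR N]trmxK NT trmxK det_gram2.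
have [|W [rW dW WN hW]] := @kernel_height R (1 + 1) k N; first by rewrite detN.
rewrite detN in hW.

pose p := dot A x; pose q := dot C x.
pose al := (dot C C * p - dot A C * q) / Dl.
pose be := (dot A A * q - dot A C * p) / Dl.
pose pr := al *: A + be *: C.
have Dln : Dl != 0 by rewrite gt_eqF.
exists W, (x - pr), (Num.sqrt Dl); split; split => //.
- rewrite WN -[toR N]trmxK NT tr_col_mx mul_mx_row.
  have zA : dot (x - pr) A = 0.
    rewrite !dotE (dotC x) (dotC C A) -/p /al /be.
    by move: Dln; rewrite /Dl => Dln; field.
  have zC : dot (x - pr) C = 0.
    rewrite !dotE (dotC x) -/q /al /be.
    by move: Dln; rewrite /Dl => Dln; field.
  rewrite [(x - pr) *m A^T]mx11_scalar [(x - pr) *m C^T]mx11_scalar.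
  by rewrite -!/(dot _ _) zA zC !raddf0 row_mx0.
- rewrite -(@ler_pXn2r _ 2) ?nnegrE ?sqrtr_ge0 //; last first.
    by rewrite (le_trans ler01) // height_ge1.
  by rewrite sqr_sqrtr // ltW.
- rewrite !enormE -sqrtrM ?dotvv_ge0 // ler_sqrt ?mulr_ge0 ?dotvv_ge0 //.
  by rewrite /Dl gerBl sqr_ge0.
rewrite subKr.
have -> : enorm pr * Num.sqrt Dl = enorm (p *: C - q *: A).
  rewrite !enormE -sqrtrM ?dotvv_ge0 //; congr Num.sqrt.
  rewrite !dotE (dotC C A) /al /be.
  by move: Dln; rewrite /Dl => Dln; field.
by rewrite (le_trans (enormD _ _)) // enormN !enormZ.
Qed.

(** With [T] the inverse of the value at [x] of the primitive form [a], whose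
kernel [V] approximates [x], the uniform exponent is used at [X = 2 T^u]: this
is just enough for the value of the form [c] so obtained to be smaller than
that of [a], whence independence. *)
Lemma going_down_uniform (k : nat) (x : 'rV[R]_(1 + k.+1)) (u v w' : R) :
  lin_indep_over_Q x -> (0 < k)%N -> 0 < v -> v <= u -> 0 <= w' ->
  w' * (u + v) < 1 - u ->
  uniform_exponent_set x u^-1 ->
  infinite_set (approximants x k.+1 v^-1) -> infinite_set (approximants x k w').
Proof.
move=> hx k0 v0 vu w'0 small [M [_ hM]] Vinf; apply: approximants_infinite => //.
  by rewrite k0 /= addnS ltnS leq_addl.
move=> e e0.
have u0 : 0 < u by exact: lt_le_trans vu.
have x0 := lin_indep_neq0 hx (ltn0Sn _).
have nx : 0 < enorm x by rewrite enorm_gt0.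
have eta0 : 0 < 1 - u - w' * (u + v) by rewrite subr_gt0.
pose c0 := 2 * enorm x; have c00 : 0 < c0 by rewrite mulr_gt0.
pose K2 := 2 * (1 + k.+1)%:R * (1 + c0 `^ v).
have n1 : 1 <= (1 + k.+1)%:R :> R by rewrite ler1n.
have cv0 : 0 < c0 `^ v by exact: powR_gt0.
have K21 : 1 <= K2.
  by rewrite /K2 -[leLHS](mulr1 1) ler_pM //; move: n1 cv0; lra.
pose K := K2 / enorm x * K2 `^ w' * Num.max 1 e^-1.
have [B B1 large] := powR_large K eta0.
have [B' B'1 large'] := powR_large M u0.
have [|B'' B''1 large''] := @powR_large R v^-1 (c0 * Num.max B B').
  by rewrite invr_gt0.
have [V [rV dV pV] BH] := northcott Vinf (fun V hV =>
  let: And3 rV dV _ := hV in conj rV dV) B''.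
set H := height V in pV BH.
have H1 : 1 <= H by exact: le_trans (ltW BH).
have H0 : 0 < H by exact: lt_le_trans H1.
have [|y yV xy] :=
    @pdist_sub_approx _ _ x V x0 (2 * H `^ (- 1 - v^-1)) (vspace_neq0 dV).
  by rewrite (le_lt_trans pV) // ltr_pMl ?powR_gt0 // ltr1n.
have [a [f [af aH aV]]] := hyperplane_normal rV dV.
have a0 : a != 0.
  apply: contraTneq (height_ge1 rV) => a0.
  by rewrite -aH a0 map_mx0 enorm0 ler10.
set p := dot (toR a) x.
have p0 : 0 < `|p| by rewrite normr_gt0; exact: dot_int_neq0.
have pH : `|p| <= c0 * H `^ (- v^-1).
  have -> : p = dot (toR a) (x - y) by rewrite !dotE (aV _ yV) subr0.
  apply: le_trans (cauchy_schwarz _ _) _; rewrite aH -/H.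
  apply: le_trans (ler_wpM2l (ltW H0) xy) _.
  rewrite [- 1 - _]addrC powRD ?(gt_eqF H0) ?implybT // powR_inv1 ?(ltW H0) //.
  rewrite le_eqVlt; apply/orP; left; apply/eqP; rewrite /c0.
  by field; rewrite gt_eqF.
pose T := `|p|^-1.
have T0 : 0 < T by rewrite invr_gt0.
have HT : H `^ v^-1 <= c0 * T.
  rewrite /T ler_pdivlMr // -ler_pdivlMl ?powR_gt0 //.
  by rewrite mulrC -powRN.
have BT : Num.max B B' < T.
  by rewrite -(ltr_pM2l c00); apply: lt_le_trans HT; exact: large''.
have TB : B < T by apply: le_lt_trans BT; rewrite le_max lexx.
have TB' : B' < T by apply: le_lt_trans BT; rewrite le_max lexx orbT.
have T1 : 1 <= T by exact: le_trans (ltW TB).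
have HTv : H <= c0 `^ v * T `^ v.
  rewrite -powRM ?(ltW c00) ?(ltW T0) // -[leLHS]powRr1 ?(ltW H0) //.
  rewrite -(mulVf (lt0r_neq0 v0)) powRrM; apply: ge0_ler_powR => //.
  - exact: ltW.
  - by rewrite nnegrE powR_ge0.
  - by rewrite nnegrE mulr_ge0 // ltW.
pose X := 2 * T `^ u.
have Tu0 : 0 < T `^ u by exact: powR_gt0.
have X0 : 0 < X by rewrite mulr_gt0.
have MX : M < X by have := large' T TB'; rewrite /X; move: Tu0; lra.
have [c [cn0 cX cx]] := hM X MX.
have cp : `|dot (toR c) x| < `|p|.
  apply: le_lt_trans cx _; rewrite powRN -[ltRHS]invrK.
  rewrite ltf_pV2 ?posrE ?powR_gt0 //.
  rewrite -/T -[ltLHS](powRr1 (ltW T0)) -(mulfV (lt0r_neq0 u0)) powRrM.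
  apply: gt0_ltr_powR; rewrite ?nnegrE ?invr_gt0 ?powR_ge0 ?(ltW X0) //.
  by rewrite /X; move: Tu0; lra.
have [W [z [D [[rW dW zW] [hD DC xzD]]]]] :=
  intersection_of_hyperplanes x (gram2_gt0 af cn0 cp).
suff [WA We] : approximants x k w' W /\ pdist_sub x W < e by exists W.
have cn : enorm (toR c) <= 2 * (1 + k.+1)%:R * T `^ u.
  rewrite -mulrA mulrCA; apply: enorm_le_coord; first exact: ltW.
  by move=> j; rewrite mxE -intr_norm.
apply: (approximants_criterion (T := T) (D := D) (K1 := K2 / enorm x)
  (K2 := K2) (al := 1 - u) (be := u + v) (z := z)) => //.
- by rewrite divr_ge0 ?(ltW nx) // (le_trans ler01).
- by rewrite addr_ge0 ?(ltW u0) ?(ltW v0).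
- apply: le_trans DC _; rewrite aH -/H powRD ?(gt_eqF T0) ?implybT //.
  apply: le_trans (ler_pM (ltW H0) (enorm_ge0 _) HTv cn) _.
  rewrite /K2 -subr_ge0.
  have -> : forall t, 2 * t * (1 + c0 `^ v) * (T `^ u * T `^ v) -
    c0 `^ v * T `^ v * (2 * t * T `^ u) = 2 * t * (T `^ u * T `^ v).
    by move=> t; ring.
  by rewrite !mulr_ge0 ?powR_ge0.
- rewrite mulrAC [K2 / _ * _]mulrAC ler_pM2r ?invr_gt0 //.
  apply: le_trans xzD _.
  have pT : `|p| = T `^ (-1) by rewrite powR_inv1 ?(ltW T0) // /T invrK.
  have -> : - (1 - u) = -1 + u by ring.
  rewrite powRD ?(gt_eqF T0) ?implybT // -pT.
  have t1 : `|p| * enorm (toR c) <= `|p| * (2 * (1 + k.+1)%:R * T `^ u).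
    by rewrite ler_pM2l.
  have t2 : `|dot (toR c) x| * enorm (toR a) <= `|p| * (c0 `^ v * T `^ u).
    apply: ler_pM => //; [exact: enorm_ge0|exact: ltW|].
    rewrite aH -/H (le_trans HTv) // ler_pM2l // ler_powR //.
  apply: le_trans (lerD t1 t2) _; rewrite -mulrDr /K2 mulrCA ler_pM2l //.
  rewrite -mulrDl ler_pM2r //.
  by move: n1 cv0; move: ((1 + k.+1)%:R : R) (c0 `^ v) => s t; nra.
by apply: (large T).
Qed.

(** Dirichlet's theorem holds with exponent [n]; the exponent [1] is all that the
positivity of the exponents requires, and it leaves room for the constants. *)
Lemma dirichlet (n : nat) (Theta : 'rV[R]_n) : (2 <= n)%N ->
  uniform_exponent_set (hpoint Theta : 'rV[R]_(1 + n)) 1.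
Proof.
move=> n2; have [C C1 mink] := minkowski_linear_forms R (1 + n).
have C0 : 0 < C by exact: lt_le_trans C1.
pose S := \sum_i `|Theta 0 i|.
have S0 : 0 <= S by apply: sumr_ge0.
pose C2 := C * (1 + S).
have C2C : C <= C2 by rewrite ler_peMr ?(ltW C0) // lerDl.
have C20 : 0 < C2 by exact: lt_le_trans C2C.
exists (C2 * (C * C2)); split; first exact: num_real.
move=> Y CY; pose X := Y / C2.
have XC : C * C2 < X by rewrite ltr_pdivlMr // mulrC.
have CC1 : 1 <= C * C2 by rewrite -[leLHS]mulr1 ler_pM // (le_trans C1).
have X1 : 1 <= X by exact: le_trans (ltW XC).
have X0 : 0 < X by exact: lt_le_trans X1.
have YE : Y = C2 * X by rewrite /X mulrC divfK // gt_eqF.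
pose Bm : 'M[R]_(1 + n) := block_mx (X ^+ n)%:M 0 (X ^+ n *: Theta^T) (X^-1)%:M.
have dB : \det Bm = 1.
  by rewrite det_lblock !det_scalar expr1 exprVn divff // expf_neq0 // gt_eqF.
have [||a a0 aB] := mink Bm isT; first by rewrite unitmxE dB unitr1.
  by rewrite dB normr1.
have haE : toR a *m (hpoint Theta)^T =
    lsubmx (toR a) + rsubmx (toR a) *m Theta^T.
  rewrite -{1}[toR a]hsubmxK; have := tr_row_mx (1%:M : 'M[R]_1) Theta.
  by rewrite -/(hpoint Theta) => ->; rewrite mul_row_col trmx1 mulmx1.
have aBE : toR a *m Bm =
    row_mx (X ^+ n *: (toR a *m (hpoint Theta)^T)) (X^-1 *: rsubmx (toR a)).
  rewrite -{1}[toR a]hsubmxK /Bm mul_row_block mulmx0 add0r !mul_mx_scalar.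
  by rewrite -scalemxAr -scalerDr haE.
have Xn0 : 0 < X ^+ n by exact: exprn_gt0.
have ax : `|dot (toR a) (hpoint Theta)| <= C / X ^+ n.
  have := aB (lshift n 0); rewrite aBE row_mxEl mxE normrM (gtr0_norm Xn0).
  by rewrite -ler_pdivlMl // mulrC.
have ar (j : 'I_n) : `|toR a 0 (rshift 1 j)| <= C * X.
  have := aB (rshift 1 j); rewrite aBE row_mxEr mxE [rsubmx _ _ _]mxE.
  by rewrite normrM normfV (gtr0_norm X0) ler_pdivrMl // mulrC.
have XnX : C / X ^+ n <= C / X.
  rewrite ler_pM2l // lef_pV2 ?posrE // -[leLHS]expr1 ler_weXn2l //.
  exact: ltnW.
exists a; split => // [i|].
  rewrite intr_norm (_ : (a 0 i)%:~R = toR a 0 i); last by rewrite mxE.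
  case: (splitP i) => j ij; last first.
    have -> : i = rshift 1 j by exact: val_inj.
    by rewrite (le_trans (ar j)) // YE ler_pM2r.
  have -> : i = lshift n 0 by apply: val_inj; rewrite /= ij (ord1 j).
  have aE : toR a 0 (lshift n 0) = dot (toR a) (hpoint Theta) -
      \sum_j toR a 0 (rshift 1 j) * Theta 0 j.
    rewrite /dot haE !mxE -[LHS](addrK (\sum_j toR a 0 (rshift 1 j) * Theta 0 j)).
    by congr (_ + _ - _); apply: eq_bigr => l _; rewrite !mxE.
  rewrite aE (le_trans (ler_normB _ _)) //.
  have t1 : `|dot (toR a) (hpoint Theta)| <= C * X.
    rewrite (le_trans ax) // (le_trans XnX) // ler_pM2l //.
    by rewrite (le_trans _ X1) // invf_le1.
  have t2 : `|\sum_j toR a 0 (rshift 1 j) * Theta 0 j| <= C * X * S.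
    rewrite (le_trans (ler_norm_sum _ _ _)) // /S mulr_sumr.
    by apply: ler_sum => l _; rewrite normrM ler_wpM2r.
  apply: le_trans (lerD t1 t2) _; rewrite YE /C2.
  by rewrite le_eqVlt; apply/orP; left; apply/eqP; ring.
have Y0 : 0 < Y by rewrite YE; exact: mulr_gt0.
rewrite powR_inv1 ?(ltW Y0) // (le_trans ax) //.
rewrite YE ler_pdivrMr // ler_pdivlMl; last exact: mulr_gt0.
have : X ^+ 2 <= X ^+ n by exact: ler_weXn2l.
rewrite expr2; apply: le_trans.
by rewrite (_ : C2 * X * C = C * C2 * X); [rewrite ler_pM2r // ltW | ring].
Qed.

End Uniform.

(** * The exponents *)

Section Exponents.

Variables (R : realType) (n : nat) (Theta : 'rV[R]_n).

Local Notation toR := (map_mx (intr : int -> R)).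
Local Notation x := (hpoint Theta : 'rV[R]_(1 + n)).

Hypothesis hx : lin_indep_over_Q x.

Lemma omega_ge (d : nat) (w : R) :
  infinite_set (approximants x d.+1 w) -> (w%:E <= omega d Theta)%E.
Proof. by move=> wi; apply: ereal_sup_ubound; exists w. Qed.

Lemma omega_gt (d : nat) (w : R) : (w%:E < omega d Theta)%E ->
  exists2 w' : R, w < w' & infinite_set (approximants x d.+1 w').
Proof.
by move=> /ereal_sup_gt[_ [w' wi <-]]; rewrite lte_fin => ww'; exists w'.
Qed.

Lemma le_of_lt_real (b : R) (y : \bar R) :
  (forall t : R, 0 <= t -> t < b -> (t%:E <= y)%E) ->
  (0 <= y)%E -> (b%:E <= y)%E.
Proof.
move=> h y0; rewrite leNgt; apply/negP; case: y y0 h => [t| |] // t0 h.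
rewrite lte_fin => tb; rewrite lee_fin in t0.
have := h ((t + b) / 2); rewrite lee_fin; lra.
Qed.

Lemma omega_going_down (d : nat) (w w' : R) : (0 < d < n)%N ->
  0 < w -> 0 <= w' -> w' * (w + d%:R + 1) < d%:R * w ->
  (w%:E < omega d Theta)%E -> (w'%:E <= omega d.-1 Theta)%E.
Proof.
move=> /andP[d0 dn] w0 w'0 ww' /omega_gt[w1 ww1 wi].
apply: omega_ge; rewrite prednK //.
apply: (going_down hx _ _ w'0 _ wi); first by rewrite d0 ltnW.
  exact: lt_trans ww1.
have wd : w' < d%:R.
  have : w' * w < d%:R * w.
    by apply: le_lt_trans ww'; rewrite -addrA mulrDr lerDl mulr_ge0 // addr_ge0.
  by rewrite ltr_pM2r.
rewrite -subr_gt0 in wd.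
by have := ltr_pM2l wd w w1; rewrite ww1; nra.
Qed.

Lemma omega_hatE : omega_hat Theta =
  ereal_sup [set w%:E | w in uniform_exponent_set x]%classic.
Proof.
have dE (a : 'rV[int]_(1 + n)) :
    dot (toR a) x = \sum_i (a 0 i)%:~R * hpoint Theta 0 i.
  by rewrite /dot mxE; apply: eq_bigr => i _; rewrite mxE [_^T _ _]mxE.
congr ereal_sup; apply/seteqP; split=> _ [w hw <-]; exists w => //;
  move: hw; apply: filterS => X [a [a0 aX ax]]; exists a; split => //.
  by rewrite dE.
by rewrite -dE.
Qed.

Lemma uniform_exponent_set_le (w w' : R) : uniform_exponent_set x w -> w' <= w -> uniform_exponent_set x w'.
Proof.
move=> hw ww'; apply: filterS2 (nbhs_pinfty_ge (num_real 1)) hw.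
move=> X X1 [a [a0 aX ax]]; exists a; split => //.
by rewrite (le_trans ax) // ler_powR // lerN2.
Qed.

Hypothesis hn : (2 <= n)%N.

Lemma omega_hat_ge1 : (1%:E <= omega_hat Theta)%E.
Proof.
rewrite omega_hatE; apply: ereal_sup_ubound; exists 1 => //; exact: dirichlet.
Qed.

Lemma omega_hat_le : (omega_hat Theta <= omega n.-1 Theta)%E.
Proof.
have n0 : (0 < n)%N by exact: leq_trans hn.
have step w w' : uniform_exponent_set x w -> 0 <= w' -> w' < w -> (w'%:E <= omega n.-1 Theta)%E.
  move=> hw w'0 ww'; apply: omega_ge; rewrite prednK //.
  exact: (uniform_le_ordinary hx n0 w'0 ww' hw).
have om0 : (0 <= omega n.-1 Theta)%E by apply: step (dirichlet Theta hn) _ _.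
rewrite omega_hatE; apply: ge_ereal_sup => _ [w hw <-].
by apply: le_of_lt_real => // t t0 tw; exact: step hw _ _.
Qed.

(** Positivity propagates downwards from [omega n.-1], which is at least
[omega_hat] and hence at least [1], by going down itself. *)
Lemma omega_gt0 (d : nat) : (d < n)%N -> (0 < omega d Theta)%E.
Proof.
move=> dn; have -> : d = (n.-1 - (n.-1 - d))%N by lia.
have : (n.-1 - d <= n.-1)%N by lia.
elim: (n.-1 - d)%N => [_|j IHj jn].
  rewrite subn0; apply: lt_le_trans omega_hat_le.
  by apply: lt_le_trans omega_hat_ge1; rewrite lte_fin.
have {IHj} om : (0 < omega (n.-1 - j) Theta)%E by apply: IHj; exact: ltnW.
have [w w0 wom] : exists2 w : R, 0 < w & (w%:E < omega (n.-1 - j) Theta)%E.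
  case: (omega _ _) om => [r||] //; last by exists 1; rewrite ?ltry.
  by rewrite lte_fin => r0; exists (r / 2); rewrite ?lte_fin; lra.
set D := (n.-1 - j)%N in om wom *.
have D0 : (0 < D < n)%N by lia.
have DR : 0 < D%:R :> R by rewrite ltr0n; case/andP: D0.
pose q := D%:R * w / (w + D%:R + 1).
have q0 : 0 < q by rewrite divr_gt0 ?mulr_gt0 // !addr_gt0.
have q20 : 0 < q / 2 by rewrite divr_gt0.
have qw : q / 2 * (w + D%:R + 1) < D%:R * w.
  have -> : q / 2 * (w + D%:R + 1) = D%:R * w / 2.
    by rewrite /q; field; rewrite gt_eqF // !addr_gt0.
  by rewrite ltr_pdivrMr // ltr_pMr ?mulr_gt0 // ltr1n.
have -> : (n.-1 - j.+1)%N = D.-1 by rewrite /D; lia.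
apply: lt_le_trans (omega_going_down D0 w0 (ltW q20) qw wom).
by rewrite lte_fin.
Qed.

Lemma going_down_exponents (d : nat) : (0 < d < n)%N ->
  (going_down_bound d (omega d Theta) <= omega d.-1 Theta)%E.
Proof.
move=> dn; have /andP[d0 dn1] := dn.
have om := omega_gt0 dn1.
have om' : (0 <= omega d.-1 Theta)%E.
  by rewrite ltW // omega_gt0 // (leq_ltn_trans (leq_pred d)).
have dR : 0 < d%:R :> R by rewrite ltr0n.
have step (t w : R) : 0 <= t -> 0 < w -> t * (w + d%:R + 1) < d%:R * w ->
  (w%:E < omega d Theta)%E -> (t%:E <= omega d.-1 Theta)%E.
  by move=> t0 w0 tw wom; exact: omega_going_down dn w0 t0 tw wom.
case: (omega d Theta) om step => [r||] // r0 step; rewrite /going_down_bound.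
  rewrite lte_fin in r0; apply: le_of_lt_real => // t t0.
  have s0 : 0 < r + d%:R + 1 by rewrite !addr_gt0.
  rewrite ltr_pdivlMr // => tr.
  have td : t < d%:R.
    have : t * r < d%:R * r.
      apply: le_lt_trans tr; rewrite -addrA mulrDr lerDl.
      by rewrite mulr_ge0 // addr_ge0 // ltW.
    by rewrite ltr_pM2r.
  rewrite -subr_gt0 in td.
  (* The [w] with [t < d w / (w + d + 1)] are those larger than [q]. *)
  pose q := t * (d%:R + 1) / (d%:R - t).
  have qr : q < r by rewrite ltr_pdivrMr //; nra.
  have q0 : 0 <= q by rewrite divr_ge0 ?(ltW td) // mulr_ge0 // addr_ge0.
  have qw w : q < w -> t * (w + d%:R + 1) < d%:R * w.
    by rewrite /q ltr_pdivrMr // => qw; lra.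
  by apply: (step t ((q + r) / 2)); rewrite ?qw ?lte_fin //; lra.
rewrite invey mule0 adde0 inve1 mule1; apply: le_of_lt_real => // t t0 td.
rewrite -subr_gt0 in td.
pose q := t * (d%:R + 1) / (d%:R - t).
have q0 : 0 <= q by rewrite divr_ge0 ?(ltW td) // mulr_ge0 // addr_ge0.
have qw w : q < w -> t * (w + d%:R + 1) < d%:R * w.
  by rewrite /q ltr_pdivrMr // => qw; lra.
by apply: (step t (q + 1)); rewrite ?qw ?ltry //; lra.
Qed.

End Exponents.

Section UniformExponent.

Variables (R : realType) (k : nat) (Theta : 'rV[R]_k.+2).

Hypothesis hx : lin_indep_over_Q (hpoint Theta).

(** Both exponents enter through upper bounds [v], [u] of their inverses, which
treats finite and infinite exponents alike. *)
Lemma omega_uniform (u v t : R) : 0 <= v -> v <= u -> 0 <= t ->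
  t * (u + v) < 1 - u ->
  (forall w : R, 0 < w -> w * u < 1 -> (w%:E < omega_hat Theta)%E) ->
  (forall w : R, 0 < w -> w * v < 1 -> (w%:E < omega k.+1 Theta)%E) ->
  (t%:E <= omega k Theta)%E.
Proof.
move=> v0 vu t0 tuv hu hv.
(* Enlarging [u] and [v] by [e] uses up half of the slack in the assumption. *)
pose e := (1 - u - t * (u + v)) / (2 * (2 * t + 1)).
have e0 : 0 < e by rewrite divr_gt0 ?mulr_gt0 //; lra.
have eE : e * (2 * (2 * t + 1)) = 1 - u - t * (u + v).
  by rewrite /e divfK // gt_eqF // mulr_gt0 //; lra.
have u'0 : 0 < u + e by lra.
have v'0 : 0 < v + e by lra.
have [w uw hw] : exists2 w, (u + e)^-1 < w & uniform_exponent_set (hpoint Theta) w.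
  have := hu (u + e)^-1; rewrite invr_gt0 omega_hatE => /(_ u'0).
  rewrite mulrC ltr_pdivrMr // mul1r ltrDl => /(_ e0) /ereal_sup_gt[_ [w hw <-]].
  by rewrite lte_fin => ?; exists w.
have [w1 vw1 wi] : exists2 w, (v + e)^-1 < w &
    infinite_set (approximants (hpoint Theta) k.+2 w).
  apply: omega_gt; apply: hv; first by rewrite invr_gt0.
  by rewrite mulrC ltr_pdivrMr // mul1r ltrDl.
have w10 : 0 < w1 by apply: lt_trans vw1; rewrite invr_gt0.
apply: omega_ge; apply: (@going_down_uniform R k.+1 _ (u + e) w1^-1 t) => //.
- by rewrite invr_gt0.
- rewrite (@le_trans _ _ (v + e)) ?lerD2r // -[leRHS]invrK lef_pV2 ?posrE ?invr_gt0 //.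
  exact: ltW.
- have : w1^-1 <= v + e.
    by rewrite -[leRHS]invrK lef_pV2 ?posrE ?invr_gt0 // ltW.
  have := e0; have := t0; have := eE; nra.
- apply: uniform_exponent_set_le hw _; exact: ltW.
by rewrite invrK.
Qed.

Lemma uniform_exponents :
  (uniform_bound (omega k.+1 Theta) (omega_hat Theta) <= omega k Theta)%E.
Proof.
have h1 := @omega_hat_ge1 R k.+2 Theta isT.
have hle := omega_hat_le hx isT.
have om0 : (0 <= omega k Theta)%E by rewrite ltW // omega_gt0.
have step := @omega_uniform.
rewrite /= in hle.
case: (omega_hat Theta) h1 hle step => [s||] // h1 hle step; last first.
  case: (omega k.+1 Theta) hle step => [r||] // _ step.
  rewrite /uniform_bound invey sube0 adde0 inve0 mul1e.
  have st (t : R) : 0 <= t -> (t%:E <= omega k Theta)%E.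
    move=> t0; apply: (step 0 0) => //; first by rewrite addr0 mulr0 subr0.
      by move=> w _ _; rewrite ltry.
    by move=> w _ _; rewrite ltry.
  case: (omega k Theta) om0 st => [r||] // r0 /(_ (r + 1)).
  by rewrite !lee_fin gerDl ler10 in r0 * => /(_ (addr_ge0 r0 ler01)).
rewrite lee_fin in h1.
have s0 : 0 < s by exact: lt_le_trans h1.
case: (omega k.+1 Theta) hle step => [r||] // hle step.
  rewrite lee_fin in hle; have r0 : 0 < r by exact: lt_le_trans hle.
  rewrite /uniform_bound; apply: le_of_lt_real => // t t0.
  rewrite ltr_pdivlMr ?addr_gt0 // => tr.
  apply: (step s^-1 r^-1) => //.
  - by rewrite invr_ge0 ltW.
  - by rewrite lef_pV2 ?posrE.
  - rewrite -(@ltr_pM2r _ (r * s)) ?mulr_gt0 //.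
    have -> : t * (s^-1 + r^-1) * (r * s) = t * (r + s) by field; rewrite !gt_eqF.
    by have -> : (1 - s^-1) * (r * s) = (s - 1) * r by field; rewrite gt_eqF.
  - by move=> w w0; rewrite ltr_pdivrMr // mul1r lte_fin.
  - by move=> w w0; rewrite ltr_pdivrMr // mul1r lte_fin.
rewrite /uniform_bound invey add0e inveK inver gt_eqF //.
rewrite -EFinB -EFinM; apply: le_of_lt_real => // t t0 ts.
apply: (step s^-1 0) => //.
- by rewrite invr_ge0 ltW.
- rewrite addr0 -ltr_pdivlMr ?invr_gt0 // invrK //.
- by move=> w w0; rewrite ltr_pdivrMr // mul1r lte_fin.
- by move=> w _ _; rewrite ltry.
Qed.

End UniformExponent.

Theorem theorem3 (R : realType) (n : nat) (Theta : 'rV[R]_n) (hn : (2 <= n)%N)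
    (hTheta : lin_indep_over_Q (hpoint Theta)) :
  (forall d : nat, (1 <= d <= n - 1)%N ->
     (going_down_bound d (omega d Theta) <= omega (d - 1) Theta)%E) /\
  (uniform_bound (omega (n - 1) Theta) (omega_hat Theta)
     <= omega (n - 2) Theta)%E.
Proof.
split=> [d dn|]; first by rewrite subn1; apply: going_down_exponents => //; lia.
case: n Theta hn hTheta => [|[|k]] // Theta _ hTheta.
by rewrite subn1 subn2; exact: uniform_exponents.
Qed.
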